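(* Let $(\mathbf Y_k)_{k\ge1}$ be a finite sequence of independent random matrices in $\mathbb H^d$ and let $(\mathbf A_k)_{k\ge1}$ be a finite sequence of deterministic matrices in $\mathbb H^d$. Assume that $$\mathbb E\,\mathbf Y_k=\mathbf 0\quad\text{and}\quad\mathbf Y_k^2\preccurlyeq\mathbf A_k^2\qquad\text{almost surely for each index }k.$$ Then, for all $t\ge0$, $$\mathbb P\Big\{\lambda_{\max}\Big(\sum_k\mathbf Y_k\Big)\ge t\Big\}\le d\cdot e^{-t^2/(2\sigma^2)}\qquad\text{for }\ \sigma^2=\frac12\Big\|\sum_k\big(\mathbf A_k^2+\mathbb E\,\mathbf Y_k^2\big)\Big\|.$$ Furthermore, $$\mathbb E\,\lambda_{\max}\Big(\sum_k\mathbf Y_k\Big)\le\sigma\sqrt{2\log d}.$$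
   Context: $\mathbb H^d$ is the space of $d\times d$ complex Hermitian matrices; $\mathbf A\preccurlyeq\mathbf B$ means $\mathbf B-\mathbf A$ is positive semidefinite; $\lambda_{\max}$ is the largest eigenvalue; $\|\cdot\|$ is the spectral norm. *)

(* Defs.v *)
From HB Require Import structures.
From mathcomp Require Import all_boot all_order all_algebra.
From mathcomp Require Export spectral sesquilinear.
From mathcomp Require Export complex.
From mathcomp Require Import all_classical all_reals all_analysis.

Set Implicit Arguments.
Unset Strict Implicit.
Unset Printing Implicit Defensive.

Import Order.TTheory GRing.Theory Num.Theory.
Import numFieldNormedType.Exports.

Local Open Scope classical_set_scope.
Local Open Scope ring_scope.
Local Open Scope complex_scope.
Local Open Scope sesquilinear_scope.

(* Complex numbers are [R[i]] with [R : realType]. Its order is partial: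
   [0 <= z] holds iff z is real and nonnegative. *)

Section matrices.
Context {R : realType} {d : nat}.
Implicit Types A B M : 'M[R[i]]_d.

(* For Hermitian A and d > 0 the set is finite, nonempty and contains every
   eigenvalue of A, so that the supremum is attained. *)
Definition lambda_max A : R := sup [set x : R | eigenvalue A x%:C].

Definition psdmx M : Prop :=
  M \is hermsymmx /\ forall u : 'cV[R[i]]_d, 0 <= (u^t* *m M *m u) 0 0.

Definition loewner_le A B : Prop := psdmx (B - A).

(* The largest singular value. *)
Definition spectral_norm A : R := Num.sqrt (lambda_max (A^t* *m A)).

(* The Borel sigma-algebra of the finite-dimensional space of matrices,
   generated by the real and imaginary parts of the entries. *)
Definition mx_borel : set (set 'M[R[i]]_d) :=
  <<s \bigcup_(ij in [set: 'I_d * 'I_d])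
        (preimage_set_system setT
           (fun M : 'M[R[i]]_d => complex.Re (M ij.1 ij.2)) measurable `|`
         preimage_set_system setT
           (fun M : 'M[R[i]]_d => complex.Im (M ij.1 ij.2)) measurable) >>.

End matrices.

Section random_matrices.
Context {R : realType} {disp : measure_display} {T : measurableType disp}.
Context {d : nat}.

Definition random_mx (X : T -> 'M[R[i]]_d) : Prop :=
  forall B, mx_borel B -> measurable (X @^-1` B).

(* Entrywise expectation. [fine] sends a non-finite value to 0: the formula is
   meaningful for integrable entries, such as those of a.s. bounded matrices. *)
Definition mx_expectation (P : probability T R) (X : T -> 'M[R[i]]_d) :
    'M[R[i]]_d :=
  \matrix_(i, j)
    (fine ('E_P[fun w => complex.Re (X w i j)])%E +i*
     fine ('E_P[fun w => complex.Im (X w i j)])%E).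

Definition mutually_independent (P : probability T R) (n : nat)
    (X : 'I_n -> T -> 'M[R[i]]_d) : Prop :=
  forall (J : {set 'I_n}) (B : 'I_n -> set 'M[R[i]]_d),
    (forall k, mx_borel (B k)) ->
    P (\bigcap_(k in [set` J]) (X k @^-1` B k)) =
    (\prod_(k in J) P (X k @^-1` B k))%E.

End random_matrices.

(* Main.v *)
(* The argument is the exchangeable-pairs method in a form that needs neither
   Lieb's theorem nor differentiation under the expectation. For X = sum_k Y_k,
   replace one summand Y_k by an independent copy: since Y_k is centred, E tr
   (Y_k exp(th X)) is half the expectation of tr ((Y_k - Y_k') (exp(th X) -
   exp(th X'))), which the trace mean value inequality bounds by th/4 times that
   of tr ((Y_k - Y_k')^2 (exp(th X) + exp(th X'))). Expanding the square and
   summing over k gives E tr (X exp(th X)) <= th sigma^2 m(th) for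
   m(th) = E tr exp(th X); by convexity this is a Groenwall inequality for m, so
   m(th) <= d exp(sigma^2 th^2 / 2). Both claims follow because
   exp(th lambda_max(X)) <= tr exp(th X). *)

Require Import Defs.
From HB Require Import structures.
From mathcomp Require Import all_boot all_order all_algebra.
From mathcomp Require Import all_classical all_reals all_analysis.
From mathcomp Require Import measurable_realfun.
From mathcomp Require Import ring lra.

Set Implicit Arguments.
Unset Strict Implicit.
Unset Printing Implicit Defensive.

Import Order.TTheory GRing.Theory Num.Theory.
Import numFieldNormedType.Exports.

Local Open Scope classical_set_scope.
Local Open Scope ring_scope.
Local Open Scope complex_scope.
Local Open Scope sesquilinear_scope.

Section complex_parts.
Context {R : realType}.
Implicit Types x y z : R[i].

Lemma cReD x y : complex.Re (x + y) = complex.Re x + complex.Re y.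
Proof. by case: x y => ? ? [? ?]. Qed.

Lemma cImD x y : complex.Im (x + y) = complex.Im x + complex.Im y.
Proof. by case: x y => ? ? [? ?]. Qed.

Lemma cReB x y : complex.Re (x - y) = complex.Re x - complex.Re y.
Proof. by case: x y => ? ? [? ?]. Qed.

Lemma cReM x y : complex.Re (x * y) =
  complex.Re x * complex.Re y - complex.Im x * complex.Im y.
Proof. by case: x y => ? ? [? ?]. Qed.

Lemma cImM x y : complex.Im (x * y) =
  complex.Re x * complex.Im y + complex.Im x * complex.Re y.
Proof. by case: x y => ? ? [? ?]. Qed.

Lemma Re_sum (I : Type) (r : seq I) (Q : pred I) (F : I -> R[i]) :
  complex.Re (\sum_(i <- r | Q i) F i) = \sum_(i <- r | Q i) complex.Re (F i).
Proof. by apply: (big_morph _ cReD). Qed.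

Lemma Im_sum (I : Type) (r : seq I) (Q : pred I) (F : I -> R[i]) :
  complex.Im (\sum_(i <- r | Q i) F i) = \sum_(i <- r | Q i) complex.Im (F i).
Proof. by apply: (big_morph _ cImD). Qed.

Lemma Re_conjM z : z * z^* = (complex.Re z ^+ 2 + complex.Im z ^+ 2)%:C.
Proof. by case: z => a b; simpc; rewrite !expr2; congr (_ +i* _); ring. Qed.

Lemma Re_mulr_real z (x : R) : complex.Re (z * x%:C) = x * complex.Re z.
Proof. by rewrite cReM /= mulr0 subr0 mulrC. Qed.

Lemma Im_mulr_real z (x : R) : complex.Im (z * x%:C) = x * complex.Im z.
Proof. by rewrite cImM /= mulr0 add0r mulrC. Qed.

End complex_parts.

Lemma expR_trapezoid (R : realType) (x : R) : 0 <= x ->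
  expR x - 1 <= x / 2 * (expR x + 1).
Proof.
move=> x0; pose g : R -> R := 2^-1 *: (id * (expR + cst 1)) - expR + cst 1.
have gE y : g y = y / 2 * (expR y + 1) - expR y + 1.
  by rewrite /g !fctE /GRing.scale /= mulrA [2^-1 * y]mulrC.
suff : g 0 <= g x by rewrite !gE expR0; lra.
have dg (y : R) : is_derive y 1 g (2^-1 * (1 + (y - 1) * expR y)).
  apply: is_derive_eq.
  by rewrite /GRing.scale /= !fctE; field.
have [->//|x_gt0] := eqVneq x 0.
have {}x_gt0 : 0 < x by rewrite lt_neqAle eq_sym x_gt0.
have cg : {within `[0, x], continuous g}.
  apply: derivable_within_continuous => y _.
  by have [] := dg y.
have [c _ dgE] := MVT_segment x0 (fun y _ => dg y) cg.
rewrite -subr_ge0 dgE mulr_ge0 ?subr0// mulr_ge0// ?invr_ge0//.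
have := expR_ge1Dx (- c); rewrite expRN => h.
have := ler_wpM2r (expR_ge0 c) h; rewrite mulVf ?gt_eqF ?expR_gt0//.
lra.
Qed.

Lemma expR_mean_value (R : realType) (th a b : R) : 0 <= th ->
  (a - b) * (expR (th * a) - expR (th * b)) <=
  th / 2 * ((a - b) ^+ 2 * (expR (th * a) + expR (th * b))).
Proof.
move=> th0; wlog ba : a b / b <= a => [hw|].
  have [/hw//|/ltW/hw] := leP b a.
  by move: (expR _) (expR _) => u v; lra.
have x0 : 0 <= th * (a - b) by rewrite mulr_ge0 ?subr_ge0.
have aE : expR (th * a) = expR (th * (a - b)) * expR (th * b).
  by rewrite -expRD; congr expR; ring.
have := expR_trapezoid x0; rewrite aE; set e := expR (th * (a - b)) => he.
have c0 : 0 <= (a - b) * expR (th * b) by rewrite mulr_ge0 ?subr_ge0 ?expR_ge0.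
have := ler_wpM2l c0 he; lra.
Qed.

(** * Functional calculus for Hermitian matrices *)

Definition eigs (R : realType) (d : nat) (H : 'M[R[i]]_d) (i : 'I_d) : R :=
  complex.Re (spectral_diag H 0 i).

(* Locked: otherwise failing unifications unfold the spectral decomposition. *)
HB.lock Definition mxfun (R : realType) (d : nat) (p : R -> R)
    (H : 'M[R[i]]_d) : 'M[R[i]]_d :=
  (spectralmx H)^t* *m diag_mx (\row_i (p (eigs H i))%:C) *m spectralmx H.

Lemma sub_sqr_mul (S : pzRingType) (x y z : S) :
  (x - y) * (x - y) * z = x * x * z - x * y * z - (y * x * z - y * y * z).
Proof. by rewrite mulrBl !mulrBr !mulrBl. Qed.

Section spectral_calculus.
Context {R : realType} {d : nat}.
Implicit Types (A B H : 'M[R[i]]_d) (p q : R -> R).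

Definition mxexp (th : R) H := mxfun (fun x => expR (th * x)) H.

Definition rtr A : R := complex.Re (\tr A).

Lemma rtrD A B : rtr (A + B) = rtr A + rtr B.
Proof. by rewrite /rtr mxtraceD cReD. Qed.

Lemma rtrB A B : rtr (A - B) = rtr A - rtr B.
Proof. by rewrite /rtr raddfB cReB. Qed.

Lemma rtr_mulC A B : rtr (A *m B) = rtr (B *m A).
Proof. by rewrite /rtr mxtrace_mulC. Qed.

Lemma rtr_sum (I : Type) (r : seq I) (F : I -> 'M[R[i]]_d) :
  rtr (\sum_(k <- r) F k) = \sum_(k <- r) rtr (F k).
Proof. by apply: (big_morph _ rtrD); rewrite /rtr mxtrace0. Qed.

Definition overlap A B (i j : 'I_d) : R :=
  let z := (spectralmx A *m (spectralmx B)^t* ) i j in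
  complex.Re z ^+ 2 + complex.Im z ^+ 2.

Lemma overlap_ge0 A B i j : 0 <= overlap A B i j.
Proof. by rewrite addr_ge0 ?sqr_ge0. Qed.

Lemma mulmx_adj_spectralmx H : spectralmx H *m (spectralmx H)^t* = 1%:M.
Proof. exact/unitarymxP/spectral_unitarymx. Qed.

Lemma mulmx_spectralmx_adj H : (spectralmx H)^t* *m spectralmx H = 1%:M.
Proof. exact/mulmx1C/mulmx_adj_spectralmx. Qed.

Lemma mxfunM p q H : mxfun p H *m mxfun q H = mxfun (p \* q) H.
Proof.
set D := fun r : R -> R => \row_i (r (eigs H i))%:C.
have -> : mxfun (p \* q) H =
    (spectralmx H)^t* *m (diag_mx (D p) *m diag_mx (D q)) *m spectralmx H.
  rewrite mulmx_diag mxfun.unlock; do 2 f_equal; f_equal.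
  by apply/rowP => i; rewrite !mxE rmorphM.
rewrite mxfun.unlock -/(D p) -/(D q); move: (diag_mx (D p)) (diag_mx (D q)) => E F.
by rewrite !mulmxA -[X in X *m F]mulmxA mulmx_adj_spectralmx mulmx1.
Qed.

Lemma mxfun1 H : mxfun (cst 1) H = 1%:M.
Proof.
rewrite mxfun.unlock (_ : diag_mx _ = 1%:M) ?mulmx1 ?mulmx_spectralmx_adj//.
by apply/matrixP => i j; rewrite !mxE; case: eqP.
Qed.

Lemma mxfun_id H : H \is hermsymmx -> mxfun id H = H.
Proof.
move=> Hh; rewrite [RHS](orthomx_spectralP (hermitian_normalmx Hh)).
rewrite invmx_unitary ?spectral_unitarymx// mxfun.unlock.
suff -> : \row_i (id (eigs H i))%:C = spectral_diag H by [].
apply/rowP => i; rewrite !mxE /eigs RRe_real//.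
exact: (mxOverP (hermitian_spectral_diag_real Hh)).
Qed.

Lemma mxfunE p H i j : mxfun p H i j =
  \sum_l (spectralmx H l i)^* * (p (eigs H l))%:C * spectralmx H l j.
Proof.
by rewrite mxfun.unlock !mxE; apply: eq_bigr => l _; rewrite mul_mx_diag !mxE.
Qed.

Lemma mxtr_mxfunM p q A B : \tr (mxfun p A *m mxfun q B) =
  (\sum_i \sum_j overlap A B i j * (p (eigs A i) * q (eigs B j)))%:C.
Proof.
rewrite mxfun.unlock; set U := spectralmx A; set V := spectralmx B.
set D := diag_mx _; set E := diag_mx _.
rewrite -!mulmxA mxtrace_mulC -!mulmxA (mulmxA U).
set W := U *m V^t*.
have -> : V *m U^t* = W^t*.
  by rewrite /W trmx_mul map_mxM map_trmx trmxK -map_mx_comp (map_mx_id (@conjCK _)).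
rewrite raddf_sum /=; apply: eq_bigr => i _.
rewrite mul_diag_mx !mxE raddf_sum /= mulr_sumr; apply: eq_bigr => j _.
rewrite mul_diag_mx !mxE !rmorphM/= /overlap -/U -/V -/W.
have -> : \sum_k U i k * V^t* k j = W i j by rewrite [RHS]mxE.
by rewrite -Re_conjM; ring.
Qed.

Lemma rtr_mxfunM p q A B : rtr (mxfun p A *m mxfun q B) =
  \sum_i \sum_j overlap A B i j * (p (eigs A i) * q (eigs B j)).
Proof. by rewrite /rtr mxtr_mxfunM. Qed.

Lemma rtr_mxfunl p A B :
  rtr (mxfun p A) = \sum_i \sum_j overlap A B i j * p (eigs A i).
Proof.
rewrite -[mxfun p A]mulmx1 -(mxfun1 B) rtr_mxfunM.
by do 2![apply: eq_bigr => ? _]; rewrite mulr1.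
Qed.

Lemma rtr_mxfunr p A B :
  rtr (mxfun p B) = \sum_i \sum_j overlap A B i j * p (eigs B j).
Proof.
rewrite -[mxfun p B]mul1mx -(mxfun1 A) rtr_mxfunM.
by do 2![apply: eq_bigr => ? _]; rewrite mul1r.
Qed.

Lemma rtr_mxfun p H : rtr (mxfun p H) = \sum_i p (eigs H i).
Proof.
rewrite /rtr mxfun.unlock mxtrace_mulC mulmxA mulmx_adj_spectralmx mul1mx /mxtrace Re_sum.
by apply: eq_bigr => i _; rewrite !mxE eqxx.
Qed.

Lemma rtr_mxfunM_le p q A B c : (forall i, p (eigs A i) <= c) ->
  (forall x, 0 <= q x) -> rtr (mxfun p A *m mxfun q B) <= c * rtr (mxfun q B).
Proof.
move=> pc q0; rewrite rtr_mxfunM.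
apply: (@le_trans _ _ (\sum_i \sum_j overlap A B i j * (c * q (eigs B j)))).
  do 2![apply: ler_sum => ? _]; rewrite ler_wpM2l ?overlap_ge0//.
  by rewrite ler_wpM2r.
rewrite (rtr_mxfunr q A) le_eqVlt; apply/orP; left; apply/eqP.
rewrite mulr_sumr; apply: eq_bigr => i _; rewrite mulr_sumr.
by apply: eq_bigr => j _ /=; ring.
Qed.

Lemma rtr_sub_mxfun e A B : A \is hermsymmx -> B \is hermsymmx ->
  rtr ((A - B) *m (mxfun e A - mxfun e B)) = \sum_i \sum_j overlap A B i j *
    ((eigs A i - eigs B j) * (e (eigs A i) - e (eigs B j))).
Proof.
move=> /mxfun_id hA /mxfun_id hB.
rewrite !(mulmxBl, mulmxBr) !rtrB.
have -> : rtr (A *m mxfun e A) = rtr (mxfun (id \* e) A).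
  by rewrite -mxfunM hA.
have -> : rtr (B *m mxfun e B) = rtr (mxfun (id \* e) B).
  by rewrite -mxfunM hB.
have -> : rtr (A *m mxfun e B) = rtr (mxfun id A *m mxfun e B) by rewrite hA.
have -> : rtr (B *m mxfun e A) = rtr (mxfun e A *m mxfun id B).
  by rewrite hB rtr_mulC.
rewrite !rtr_mxfunM (rtr_mxfunl _ A B) (rtr_mxfunr _ A B) -!sumrB; apply: eq_bigr => i _.
by rewrite -!sumrB; apply: eq_bigr => j _ /=; ring.
Qed.

Lemma rtr_sub_mul A B E F : rtr ((A - B) *m (E - F)) =
  rtr (A *m E) - rtr (A *m F) - (rtr (B *m E) - rtr (B *m F)).
Proof. by rewrite mulmxBl (mulmxBr A) (mulmxBr B) !rtrB. Qed.

Lemma rtr_sub_sqr A B E F x1 x2 x3 x4 y1 y2 y3 y4 :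
  rtr (A *m A *m E) = x1 -> rtr (A *m B *m E) = x2 ->
  rtr (B *m A *m E) = x3 -> rtr (B *m B *m E) = x4 ->
  rtr (A *m A *m F) = y1 -> rtr (A *m B *m F) = y2 ->
  rtr (B *m A *m F) = y3 -> rtr (B *m B *m F) = y4 ->
  rtr ((A - B) *m (A - B) *m (E + F)) =
  x1 - x2 - (x3 - x4) + (y1 - y2 - (y3 - y4)).
Proof.
move=> <- <- <- <- <- <- <- <-; rewrite mulmxDr rtrD -!rtrB.
by congr (rtr _ + rtr _); exact: sub_sqr_mul.
Qed.

Lemma rtr_sub_sqr_mxfun e A B : A \is hermsymmx -> B \is hermsymmx ->
  rtr ((A - B) *m (A - B) *m (mxfun e A + mxfun e B)) =
  \sum_i \sum_j overlap A B i j *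
    ((eigs A i - eigs B j) ^+ 2 * (e (eigs A i) + e (eigs B j))).
Proof.
move=> /mxfun_id hA /mxfun_id hB; set S := RHS.
have t1 : rtr (A *m A *m mxfun e A) =
    rtr (mxfun (id \* (id \* e)) A).
  by rewrite -!mxfunM hA mulmxA.
have t2 : rtr (B *m B *m mxfun e B) =
    rtr (mxfun (id \* (id \* e)) B).
  by rewrite -!mxfunM hB mulmxA.
have t3 : rtr (A *m A *m mxfun e B) = rtr (mxfun (id \* id) A *m mxfun e B).
  by rewrite -!mxfunM hA.
have t4 : rtr (B *m B *m mxfun e A) = rtr (mxfun e A *m mxfun (id \* id) B).
  by rewrite -!mxfunM hB rtr_mulC.
have t5 : rtr (A *m B *m mxfun e A) = rtr (mxfun (e \* id) A *m mxfun id B).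
  by rewrite -!mxfunM hB hA rtr_mulC mulmxA.
have t6 : rtr (A *m B *m mxfun e B) = rtr (mxfun id A *m mxfun (id \* e) B).
  by rewrite -!mxfunM hB hA mulmxA.
have t7 : rtr (B *m A *m mxfun e A) = rtr (mxfun (id \* e) A *m mxfun id B).
  by rewrite -!mxfunM hB hA -mulmxA rtr_mulC.
have t8 : rtr (B *m A *m mxfun e B) = rtr (mxfun id A *m mxfun (e \* id) B).
  by rewrite -!mxfunM hB hA -mulmxA rtr_mulC mulmxA.
rewrite (rtr_sub_sqr t1 t5 t7 t4 t3 t6 t8 t2).
rewrite !rtr_mxfunM (rtr_mxfunl _ A B) (rtr_mxfunr _ A B).
rewrite -!(sumrB, big_split) /=; apply: eq_bigr => i _.
rewrite -!(sumrB, big_split) /=; apply: eq_bigr => j _.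
ring.
Qed.

Lemma tr_exp_mean_value th A B : 0 <= th -> A \is hermsymmx -> B \is hermsymmx ->
  rtr ((A - B) *m (mxexp th A - mxexp th B)) <=
  th / 2 * rtr ((A - B) *m (A - B) *m (mxexp th A + mxexp th B)).
Proof.
move=> th0 hA hB; rewrite rtr_sub_mxfun// rtr_sub_sqr_mxfun//.
rewrite mulr_sumr; apply: ler_sum => i _.
rewrite mulr_sumr; apply: ler_sum => j _.
rewrite [leRHS]mulrCA ler_wpM2l ?overlap_ge0//.
exact: expR_mean_value.
Qed.

End spectral_calculus.

Section eigenvalues.
Context {R : realType} {d : nat}.
Implicit Types (A B H M : 'M[R[i]]_d) (p q : R -> R).

Lemma hermsymmxP A : reflect (A^t* = A) (A \is hermsymmx).
Proof.
apply: (iffP (is_hermitianmxP _ _ _)); rewrite expr0 scale1r.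
  by move=> <-.
by move=> ->.
Qed.

Lemma hermsymmxD A B : A \is hermsymmx -> B \is hermsymmx -> A + B \is hermsymmx.
Proof.
move=> /hermsymmxP hA /hermsymmxP hB; apply/hermsymmxP.
by rewrite linearD /= map_mxD hA hB.
Qed.

Lemma hermsymmx0 : (0 : 'M[R[i]]_d) \is hermsymmx.
Proof. by apply/hermsymmxP; rewrite trmx0 map_mx0. Qed.

Lemma hermsymmx_sum (I : Type) (r : seq I) (Q : pred I) (F : I -> 'M[R[i]]_d) :
  (forall i, F i \is hermsymmx) -> \sum_(i <- r | Q i) F i \is hermsymmx.
Proof.
move=> h; apply: (big_ind (fun M => M \is hermsymmx)).
- exact: hermsymmx0.
- exact: hermsymmxD.
- by move=> i _; exact: h.
Qed.

Lemma hermsymmx_sqr A : A \is hermsymmx -> A ^+ 2 \is hermsymmx.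
Proof.
move=> /hermsymmxP hA; apply/hermsymmxP.
by rewrite expr2 trmx_mul map_mxM hA.
Qed.

Lemma mxfun_herm p H : mxfun p H \is hermsymmx.
Proof.
apply/hermsymmxP; rewrite mxfun.unlock; set D := diag_mx _.
have hD : D^t* = D.
  apply/matrixP => i j; rewrite !mxE eq_sym.
  by case: eqP => [->|_]; rewrite ?mulr1n ?mulr0n ?conjC0//; exact: conjc_real.
rewrite !trmx_mul !map_mxM hD mulmxA.
by rewrite map_trmx trmxK -map_mx_comp (map_mx_id (@conjCK _)).
Qed.

Lemma mxfunX H k : H \is hermsymmx -> mxfun (fun x => x ^+ k) H = H ^+ k.
Proof.
move=> hH; elim: k => [|k IH]; first exact: (mxfun1 H).
transitivity (mxfun id H *m mxfun (fun x => x ^+ k) H).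
  by rewrite mxfunM; congr (mxfun _ _); apply/funext => x /=; rewrite exprS.
by rewrite exprS -IH mxfun_id.
Qed.

Lemma spectralmx_mul H : H \is hermsymmx ->
  spectralmx H *m H = diag_mx (\row_i (eigs H i)%:C) *m spectralmx H.
Proof.
move=> hH; rewrite -{2}(mxfun_id hH) mxfun.unlock !mulmxA mulmx_adj_spectralmx.
by rewrite mul1mx.
Qed.

Lemma mulmx_spectralmx_adjr H : H \is hermsymmx ->
  H *m (spectralmx H)^t* = (spectralmx H)^t* *m diag_mx (\row_i (eigs H i)%:C).
Proof.
move=> /spectralmx_mul; have := mulmx_spectralmx_adj H.
have := mulmx_adj_spectralmx H.
move: (spectralmx H) ((spectralmx H)^t*) (diag_mx _) => U V D UV VU UH.
by rewrite -[LHS]mul1mx -VU -(mulmxA V U) (mulmxA U H) UH -(mulmxA D) UV mulmx1.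
Qed.

Lemma row_spectralmx_mul H i : H \is hermsymmx ->
  row i (spectralmx H) *m H = (eigs H i)%:C *: row i (spectralmx H).
Proof.
move=> hH; rewrite -row_mul spectralmx_mul// row_mul row_diag_mx.
by rewrite -scalemxAl -rowE !mxE.
Qed.

Lemma row_spectralmx_neq0 H i : row i (spectralmx H) != 0.
Proof.
apply/eqP => h; have /matrixP/(_ i i) := mulmx_adj_spectralmx H.
rewrite !mxE eqxx big1 => [/esym/eqP|j _]; first by rewrite oner_eq0.
by have /rowP/(_ j) := h; rewrite !mxE => ->; rewrite mul0r.
Qed.

Lemma eigenvalueE H x : H \is hermsymmx ->
  eigenvalue H x%:C <-> exists i, x = eigs H i.
Proof.
move=> hH; split => [/eigenvalueP[v vH v0]|[i ->]]; last first.
  apply/eigenvalueP; exists (row i (spectralmx H)); last exact: row_spectralmx_neq0.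
  exact: row_spectralmx_mul.
pose u := v *m (spectralmx H)^t*.
have vE : v = u *m spectralmx H.
  by rewrite /u -mulmxA mulmx_spectralmx_adj mulmx1.
have /rV0Pn[i ui] : u != 0.
  by apply: contra_neq v0 => u0; rewrite vE u0 mul0mx.
exists i; apply: complexI; apply: (mulfI ui).
have : u *m diag_mx (\row_i (eigs H i)%:C) = x%:C *: u.
  rewrite /u scalemxAl -vH -!mulmxA; congr (_ *m _).
  exact/esym/mulmx_spectralmx_adjr.
move: u {vE} ui => u ui /rowP/(_ i); rewrite mul_mx_diag !mxE => ->.
by rewrite mulrC.
Qed.

Lemma eigenvalues_bounded H : H \is hermsymmx ->
  has_ubound [set x : R | eigenvalue H x%:C].
Proof.
move=> hH; exists (\sum_i `|eigs H i|) => _ /(eigenvalueE _ hH)[i ->].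
rewrite (bigD1 i)//= (le_trans (ler_norm _))// lerDl.
exact: sumr_ge0.
Qed.

Lemma eigs_le_lambda_max H i : H \is hermsymmx -> eigs H i <= lambda_max H.
Proof.
move=> hH; apply: ub_le_sup; first exact: eigenvalues_bounded.
by apply/(eigenvalueE _ hH); exists i.
Qed.

Lemma lambda_max_attained H : (0 < d)%N -> H \is hermsymmx ->
  exists i, lambda_max H = eigs H i.
Proof.
move=> d0 hH; pose i0 := Ordinal d0.
have [i _ imax] := @arg_maxP _ _ _ i0 xpredT (eigs H) isT.
exists i; apply/le_anti; rewrite eigs_le_lambda_max// andbT.
apply: ge_sup; first by exists (eigs H i); apply/(eigenvalueE _ hH); exists i.
by move=> _ /(eigenvalueE _ hH)[j ->]; exact: imax.
Qed.

Lemma eigs_le_spectral_norm M i : M \is hermsymmx -> eigs M i <= spectral_norm M.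
Proof.
move=> hM; rewrite (le_trans (ler_norm _))// -sqrtr_sqr ler_wsqrtr//.
have hM2 : M^t* *m M \is hermsymmx.
  by have /hermsymmxP -> := hM; exact: hermsymmx_sqr.
apply: ub_le_sup; first exact: eigenvalues_bounded.
rewrite /=; apply/eigenvalueP; exists (row i (spectralmx M)).
  have /hermsymmxP -> := hM; rewrite mulmxA row_spectralmx_mul//.
  by rewrite -scalemxAl row_spectralmx_mul// scalerA expr2 rmorphM.
exact: row_spectralmx_neq0.
Qed.

Lemma psdmx_eigs_ge0 M i : psdmx M -> 0 <= eigs M i.
Proof.
move=> [hM /(_ ((row i (spectralmx M))^t*))].
rewrite trmxCK row_spectralmx_mul// -scalemxAl mxE.
have -> : (row i (spectralmx M) *m (row i (spectralmx M))^t*) 0 0 = 1.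
  have /matrixP/(_ i i) := mulmx_adj_spectralmx M.
  by rewrite !mxE eqxx mulr1n => <-; apply: eq_bigr => j _; rewrite !mxE.
by rewrite mulr1 ler0c.
Qed.

Lemma rtr_psdmx_mul_ge0 M H q : psdmx M -> (forall x, 0 <= q x) ->
  0 <= rtr (M *m mxfun q H).
Proof.
move=> pM q0; rewrite -(mxfun_id pM.1) rtr_mxfunM.
do 2![apply: sumr_ge0 => ? _]; rewrite mulr_ge0 ?overlap_ge0// mulr_ge0//.
exact: psdmx_eigs_ge0.
Qed.

Lemma sum_sqr_entries H : H \is hermsymmx ->
  \sum_i \sum_j (complex.Re (H i j) ^+ 2 + complex.Im (H i j) ^+ 2) = rtr (H ^+ 2).
Proof.
move=> /hermsymmxP hH; rewrite /rtr /mxtrace Re_sum; apply: eq_bigr => i _.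
rewrite expr2 mxE Re_sum; apply: eq_bigr => j _.
suff -> : H j i = (H i j)^* by rewrite Re_conjM.
by rewrite -[in LHS]hH !mxE.
Qed.

Lemma sum_sqr_entries_eigs H : H \is hermsymmx ->
  \sum_i \sum_j (complex.Re (H i j) ^+ 2 + complex.Im (H i j) ^+ 2) =
  \sum_i (eigs H i) ^+ 2.
Proof. by move=> hH; rewrite sum_sqr_entries// -mxfunX// rtr_mxfun. Qed.

Lemma sqr_entry_le H i j :
  complex.Re (H i j) ^+ 2 + complex.Im (H i j) ^+ 2 <=
  \sum_i \sum_j (complex.Re (H i j) ^+ 2 + complex.Im (H i j) ^+ 2).
Proof.
rewrite [leRHS](bigD1 i)//= [X in _ <= X + _](bigD1 j)//= -addrA lerDl.
by rewrite addr_ge0//; do ?[apply: sumr_ge0 => ? _]; rewrite addr_ge0 ?sqr_ge0.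
Qed.

Definition entries_le (C : R) H :=
  forall i j, `|complex.Re (H i j)| <= C /\ `|complex.Im (H i j)| <= C.

Lemma eigs_bounded C H i : H \is hermsymmx -> entries_le C H ->
  `|eigs H i| <= 1 + \sum_(i < d) \sum_(j < d) (C ^+ 2 + C ^+ 2).
Proof.
move=> hH HC; apply: (@le_trans _ _ (1 + eigs H i ^+ 2)).
  rewrite -(real_normK (num_real (eigs H i))).
  by have := sqr_ge0 (`|eigs H i| - 1); have := normr_ge0 (eigs H i); nra.
rewrite lerD2l; apply: (@le_trans _ _ (\sum_i (eigs H i) ^+ 2)).
  by rewrite (bigD1 i)//= lerDl sumr_ge0// => ? _; rewrite sqr_ge0.
have sqr_le z : `|z| <= C -> z ^+ 2 <= C ^+ 2.
  move=> zC; rewrite -real_normK ?num_real// lerXn2r// nnegrE.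
  exact: le_trans (normr_ge0 z) zC.
rewrite -sum_sqr_entries_eigs//; apply: ler_sum => a _; apply: ler_sum => b _.
by have [h1 h2] := HC a b; apply: lerD; exact: sqr_le.
Qed.

Lemma mxfun_entries_le p H K : 0 <= K -> (forall i, `|p (eigs H i)| <= K) ->
  entries_le (1 + \sum_(i < d) K ^+ 2) (mxfun p H).
Proof.
move=> K0 pK i j; have := sqr_entry_le (mxfun p H) i j.
have pE : rtr (mxfun p H ^+ 2) = \sum_i p (eigs H i) ^+ 2.
  transitivity (rtr (mxfun p H *m mxfun p H)); first by [].
  by rewrite mxfunM rtr_mxfun.
rewrite sum_sqr_entries ?mxfun_herm// pE.
set S := \sum_i (_); set x := complex.Re _; set y := complex.Im _.
have : S <= \sum_(i < d) K ^+ 2.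
  by apply: ler_sum => k _; rewrite -real_normK ?num_real// lerXn2r.
set T := \sum_(_ < _) _ => ST xyS.
have h z : z ^+ 2 <= T -> `|z| <= 1 + T.
  move=> zT; rewrite (@le_trans _ _ (1 + z ^+ 2)) ?lerD2l//.
  rewrite -(real_normK (num_real z)).
  by have := sqr_ge0 (`|z| - 1); have := normr_ge0 z; nra.
by split; apply: h; have := sqr_ge0 x; have := sqr_ge0 y; lra.
Qed.

Lemma expR_le_rtr_mxexp th H : (0 < d)%N -> H \is hermsymmx ->
  expR (th * lambda_max H) <= rtr (mxexp th H).
Proof.
move=> d0 hH; have [i ->] := lambda_max_attained d0 hH.
rewrite rtr_mxfun (bigD1 i)//= lerDl sumr_ge0// => j _; exact: expR_ge0.
Qed.

Lemma rtr_mxexp_le th H : 0 <= th -> H \is hermsymmx ->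
  rtr (mxexp th H) <= d%:R * expR (th * lambda_max H).
Proof.
move=> th0 hH; rewrite rtr_mxfun.
rewrite (@le_trans _ _ (\sum_(i < d) expR (th * lambda_max H)))//.
  by apply: ler_sum => i _; rewrite ler_expR ler_wpM2l// eigs_le_lambda_max.
by rewrite sumr_const card_ord mulr_natl.
Qed.

Definition mxexp_trunc th N H : 'M[R[i]]_d :=
  \sum_(k < N) (th ^+ k / k`!%:R)%:C *: H ^+ k.

Lemma mxexp_truncE th N H : H \is hermsymmx ->
  mxexp_trunc th N H = mxfun (fun x => series (exp_coeff (th * x)) N) H.
Proof.
move=> hH; apply/matrixP => i j; rewrite summxE mxfunE.
under eq_bigr do rewrite -mxfunX// mxE mxfunE mulr_sumr.
rewrite exchange_big /=; apply: eq_bigr => l _.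
rewrite /series /= big_mkord rmorph_sum /= mulr_sumr mulr_suml.
apply: eq_bigr => k _; rewrite /exp_coeff /= exprMn !rmorphM /=; ring.
Qed.

Lemma Re_mxfun_entry p H i j : complex.Re (mxfun p H i j) =
  \sum_l p (eigs H l) * complex.Re ((spectralmx H l i)^* * spectralmx H l j).
Proof.
rewrite mxfunE Re_sum; apply: eq_bigr => l _.
by rewrite mulrAC; exact: Re_mulr_real.
Qed.

Lemma Im_mxfun_entry p H i j : complex.Im (mxfun p H i j) =
  \sum_l p (eigs H l) * complex.Im ((spectralmx H l i)^* * spectralmx H l j).
Proof.
rewrite mxfunE Im_sum; apply: eq_bigr => l _.
by rewrite mulrAC; exact: Im_mulr_real.
Qed.

Let cvg_mxfun th H (c : 'I_d -> R) :
  \sum_l series (exp_coeff (th * eigs H l)) N * c l @[N --> \oo] -->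
  \sum_l expR (th * eigs H l) * c l.
Proof.
apply: cvg_big => [x|l _]; first exact: add_continuous.
by apply: cvgMl; exact: is_cvg_series_exp_coeff.
Qed.

Lemma cvg_Re_mxexp th H i j : H \is hermsymmx ->
  complex.Re (mxexp_trunc th N H i j) @[N --> \oo] --> complex.Re (mxexp th H i j).
Proof.
move=> hH; rewrite Re_mxfun_entry.
under eq_fun do rewrite mxexp_truncE// Re_mxfun_entry.
exact: cvg_mxfun.
Qed.

Lemma cvg_Im_mxexp th H i j : H \is hermsymmx ->
  complex.Im (mxexp_trunc th N H i j) @[N --> \oo] --> complex.Im (mxexp th H i j).
Proof.
move=> hH; rewrite Im_mxfun_entry.
under eq_fun do rewrite mxexp_truncE// Im_mxfun_entry.
exact: cvg_mxfun.
Qed.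

End eigenvalues.

(** * Bounded random matrices *)

Section bounded_measurable.
Context {R : realType} {d0 : measure_display} {T : measurableType d0}.
Implicit Types (f g : T -> R) (P : probability T R).

Definition bmeas f := measurable_fun setT f /\ exists C, forall w, `|f w| <= C.

Lemma bmeas_cst (c : R) : bmeas (cst c).
Proof. by split; [exact: measurable_cst|exists `|c|]. Qed.

Lemma bmeasD f g : bmeas f -> bmeas g -> bmeas (fun w => f w + g w).
Proof.
move=> [mf [C fC]] [mg [D gD]]; split; first exact: measurable_funD.
by exists (C + D) => w; rewrite (le_trans (ler_normD _ _))// lerD.
Qed.

Lemma bmeasM f g : bmeas f -> bmeas g -> bmeas (fun w => f w * g w).
Proof.
move=> [mf [C fC]] [mg [D gD]]; split; first exact: measurable_funM.
by exists (C * D) => w; rewrite normrM ler_pM.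
Qed.

Lemma bmeasB f g : bmeas f -> bmeas g -> bmeas (fun w => f w - g w).
Proof.
move=> bf bg; have -> : (fun w => f w - g w) = (fun w => f w + (cst (-1) w) * g w).
  by apply/funext => w /=; rewrite mulN1r.
exact/bmeasD/bmeasM/bg/bmeas_cst.
Qed.

Lemma bmeas_integrable P f : bmeas f -> P.-integrable setT (EFin \o f).
Proof.
move=> [mf [C fC]]; apply: measurable_bounded_integrable => //.
  exact: le_lt_trans (probability_le1 P measurableT) (ltry _).
by exists C; split => [|x Cx w _]; [exact: num_real|exact: le_trans (fC w) (ltW Cx)].
Qed.

Lemma bmeas_RintegralD P f g : bmeas f -> bmeas g ->
  \int[P]_w (f w + g w) = \int[P]_w f w + \int[P]_w g w.
Proof. by move=> bf bg; apply: RintegralD => //; exact: bmeas_integrable. Qed.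

Lemma bmeas_RintegralB P f g : bmeas f -> bmeas g ->
  \int[P]_w (f w - g w) = \int[P]_w f w - \int[P]_w g w.
Proof. by move=> bf bg; apply: RintegralB => //; exact: bmeas_integrable. Qed.

Lemma bmeas_RintegralZ P f c : bmeas f ->
  \int[P]_w (c * f w) = c * \int[P]_w f w.
Proof. by move=> bf; apply: RintegralZl => //; exact: bmeas_integrable. Qed.

Lemma bmeas_Rintegral_cst P (c : R) : \int[P]_w c = c.
Proof. by rewrite Rintegral_cst//= probability_setT mulr1. Qed.

Lemma bmeas_le_Rintegral P f g : bmeas f -> bmeas g ->
  (forall w, f w <= g w) -> \int[P]_w f w <= \int[P]_w g w.
Proof.
by move=> bf bg fg; apply: le_Rintegral => //; exact: bmeas_integrable.
Qed.

Lemma bmeas_RintegralE P f : bmeas f ->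
  (\int[P]_w (f w)%:E)%E = (\int[P]_w f w)%:E.
Proof.
by move=> bf; rewrite fineK//; apply: integrable_fin_num => //; exact: bmeas_integrable.
Qed.

Lemma bmeas_ae_le_Rintegral P f g : bmeas f -> bmeas g ->
  {ae P, forall w, f w <= g w} -> \int[P]_w f w <= \int[P]_w g w.
Proof.
move=> bf bg fg; have [C fC] := bf.2; have [D gD] := bg.2.
pose c := C + D.
have ge0 h : (h = f \/ h = g) -> forall w, 0 <= h w + c.
  have cC : C <= c by rewrite lerDl (le_trans _ (gD point)).
  have cD : D <= c by rewrite lerDr (le_trans _ (fC point)).
  have norm_ge0 x : `|x| <= c -> 0 <= x + c.
    by rewrite ler_norml => /andP[? _]; lra.
  by move=> [] -> w; apply: norm_ge0;
    [exact: le_trans (fC w) cC|exact: le_trans (gD w) cD].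
have bfc : bmeas (fun w => f w + c) by apply: bmeasD => //; exact: bmeas_cst.
have bgc : bmeas (fun w => g w + c) by apply: bmeasD => //; exact: bmeas_cst.
rewrite -(lerD2r c) -{1}(bmeas_Rintegral_cst P c) -{2}(bmeas_Rintegral_cst P c).
rewrite -!bmeas_RintegralD//; try exact: bmeas_cst.
rewrite -lee_fin -!bmeas_RintegralE//.
apply: ae_ge0_le_integral => //.
- by move=> w _; rewrite lee_fin ge0//; left.
- exact/measurable_EFinP/bfc.1.
- by move=> w _; rewrite lee_fin ge0//; right.
- exact/measurable_EFinP/bgc.1.
- by apply: filterS fg => w fgw _; rewrite lee_fin lerD2r.
Qed.

End bounded_measurable.

Lemma bmeas_comp (R : realType) (d1 d2 : measure_display) (T1 : measurableType d1)
    (T2 : measurableType d2) (phi : T1 -> T2) (f : T2 -> R) :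
  measurable_fun setT phi -> bmeas f -> bmeas (f \o phi).
Proof.
move=> mphi [mf [C fC]]; split; first exact: measurableT_comp.
by exists C => w; exact: fC.
Qed.

Section bounded_measurable_complex.
Context {R : realType} {d0 : measure_display} {T : measurableType d0}.
Implicit Types (f g : T -> R[i]) (P : probability T R).

Definition cbmeas f :=
  bmeas (fun w => complex.Re (f w)) /\ bmeas (fun w => complex.Im (f w)).

Definition cexp P f : R[i] :=
  (\int[P]_w complex.Re (f w)) +i* (\int[P]_w complex.Im (f w)).

Lemma cbmeas_cst (c : R[i]) : cbmeas (cst c).
Proof. by split; exact: bmeas_cst. Qed.

Lemma cbmeasD f g : cbmeas f -> cbmeas g -> cbmeas (fun w => f w + g w).
Proof.
move=> [f1 f2] [g1 g2]; split.
  by under eq_fun do rewrite cReD; exact: bmeasD.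
by under eq_fun do rewrite cImD; exact: bmeasD.
Qed.

Lemma cbmeasM f g : cbmeas f -> cbmeas g -> cbmeas (fun w => f w * g w).
Proof.
move=> [f1 f2] [g1 g2]; split.
by under eq_fun do rewrite cReM; apply: bmeasB; exact: bmeasM.
by under eq_fun do rewrite cImM; apply: bmeasD; exact: bmeasM.
Qed.

Lemma cbmeas_sum (I : Type) (r : seq I) (F : I -> T -> R[i]) :
  (forall i, cbmeas (F i)) -> cbmeas (fun w => \sum_(i <- r) F i w).
Proof.
move=> bF; elim: r => [|i r IH].
  by under eq_fun do rewrite big_nil; exact: cbmeas_cst.
by under eq_fun do rewrite big_cons; exact: cbmeasD.
Qed.

Lemma cexp_cst P (c : R[i]) : cexp P (cst c) = c.
Proof. by rewrite /cexp !bmeas_Rintegral_cst; case: c. Qed.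

Lemma cexpD P f g : cbmeas f -> cbmeas g ->
  cexp P (fun w => f w + g w) = cexp P f + cexp P g.
Proof.
move=> [f1 f2] [g1 g2]; rewrite /cexp.
under eq_Rintegral do rewrite cReD.
under [X in _ +i* X]eq_Rintegral do rewrite cImD.
by rewrite !bmeas_RintegralD.
Qed.

Lemma cexpZ P f c : cbmeas f -> cexp P (fun w => c * f w) = c * cexp P f.
Proof.
move=> [f1 f2]; rewrite /cexp.
under eq_Rintegral do rewrite cReM.
under [X in _ +i* X]eq_Rintegral do rewrite cImM.
have bZ (x : R) (g : T -> R) : bmeas g -> bmeas (fun w => x * g w).
  by move=> bg; apply: (bmeasM (bmeas_cst x)).
rewrite bmeas_RintegralB; try exact: bZ.
rewrite bmeas_RintegralD; try exact: bZ.
by rewrite !bmeas_RintegralZ//; case: c.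
Qed.

Lemma cexp_sum (I : Type) (r : seq I) P (F : I -> T -> R[i]) :
  (forall i, cbmeas (F i)) ->
  cexp P (fun w => \sum_(i <- r) F i w) = \sum_(i <- r) cexp P (F i).
Proof.
move=> bF; elim: r => [|i r IH].
  have -> : (fun w => \sum_(i <- [::]) F i w) = cst 0.
    by apply/funext => w; rewrite big_nil.
  by rewrite cexp_cst big_nil.
have -> : (fun w => \sum_(j <- i :: r) F j w) = (fun w => F i w + \sum_(j <- r) F j w).
  by apply/funext => w; rewrite big_cons.
by rewrite cexpD ?big_cons ?IH//; exact: cbmeas_sum.
Qed.

End bounded_measurable_complex.

Section bounded_measurable_matrix.
Context {R : realType} {d0 : measure_display} {T : measurableType d0} {d : nat}.
Implicit Types (X Y : T -> 'M[R[i]]_d) (P : probability T R).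

Definition bmx X := forall i j, cbmeas (fun w => X w i j).

Lemma bmx_cst (M : 'M[R[i]]_d) : bmx (cst M).
Proof. by move=> i j; exact: cbmeas_cst. Qed.

Lemma bmxD X Y : bmx X -> bmx Y -> bmx (fun w => X w + Y w).
Proof.
by move=> bX bY i j; under eq_fun do rewrite mxE; exact: cbmeasD.
Qed.

Lemma bmxM X Y : bmx X -> bmx Y -> bmx (fun w => X w *m Y w).
Proof.
move=> bX bY i j; under eq_fun do rewrite mxE.
by apply: cbmeas_sum => k; exact: cbmeasM.
Qed.

Lemma bmxMl (M : 'M[R[i]]_d) X : bmx X -> bmx (fun w => M *m X w).
Proof. by move=> bX; apply: (bmxM (bmx_cst M)). Qed.

Lemma bmxMr (M : 'M[R[i]]_d) X : bmx X -> bmx (fun w => X w *m M).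
Proof. by move=> bX; apply: (bmxM bX (bmx_cst M)). Qed.

Lemma bmx_sum (I : Type) (r : seq I) (Q : pred I) (F : I -> T -> 'M[R[i]]_d) :
  (forall i, bmx (F i)) -> bmx (fun w => \sum_(i <- r | Q i) F i w).
Proof.
move=> bF; elim: r => [|i r IH].
  by under eq_fun do rewrite big_nil; exact: bmx_cst.
under eq_fun do rewrite big_cons.
by case: (Q i) => //; exact: bmxD.
Qed.

Lemma bmxX X k : bmx X -> bmx (fun w => X w ^+ k).
Proof.
move=> bX; elim: k => [|k IH].
  by under eq_fun do rewrite expr0; exact: bmx_cst.
by under eq_fun do rewrite exprS; exact: bmxM.
Qed.

Lemma mx_expectationE P X :
  mx_expectation P X = \matrix_(i, j) cexp P (fun w => X w i j).
Proof. by apply/matrixP => i j; rewrite !mxE unlock. Qed.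

Lemma mx_expectationMl P (M : 'M[R[i]]_d) X : bmx X ->
  mx_expectation P (fun w => M *m X w) = M *m mx_expectation P X.
Proof.
move=> bX; rewrite !mx_expectationE; apply/matrixP => i j; rewrite !mxE.
under eq_bigr do rewrite mxE -cexpZ//.
rewrite -cexp_sum => [|k]; last by apply: (cbmeasM (cbmeas_cst _)).
by congr cexp; apply/funext => w; rewrite mxE.
Qed.

Lemma mx_expectationMr P (M : 'M[R[i]]_d) X : bmx X ->
  mx_expectation P (fun w => X w *m M) = mx_expectation P X *m M.
Proof.
move=> bX; rewrite !mx_expectationE; apply/matrixP => i j; rewrite !mxE.
under eq_bigr do rewrite mxE mulrC -cexpZ//.
rewrite -cexp_sum => [|k]; last by apply: (cbmeasM (cbmeas_cst _)).
congr cexp; apply/funext => w; rewrite mxE.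
by apply: eq_bigr => k _; rewrite mulrC.
Qed.

Lemma bmeas_rtr X : bmx X -> bmeas (fun w => rtr (X w)).
Proof. by move=> bX; have [] := cbmeas_sum (index_enum 'I_d) (fun i => bX i i). Qed.

Lemma Rintegral_rtr P X : bmx X ->
  \int[P]_w rtr (X w) = rtr (mx_expectation P X).
Proof.
move=> bX; have := cexp_sum (index_enum 'I_d) P (fun i => bX i i).
move=> /(congr1 (@complex.Re R)) /= E; rewrite [LHS]E /rtr mx_expectationE /mxtrace.
by congr complex.Re; apply: eq_bigr => i _; rewrite mxE.
Qed.

Lemma bmx_entries_le X : bmx X -> exists2 C, 0 <= C & forall w, entries_le C (X w).
Proof.
move=> bX; pose b i j (C : R) := 0 <= C /\
  forall w, `|complex.Re (X w i j)| <= C /\ `|complex.Im (X w i j)| <= C.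
have hb i j : exists C, b i j C.
  have [[_ [C hC]] [_ [D hD]]] := bX i j; exists (C + D).
  have C0 : 0 <= C := le_trans (normr_ge0 _) (hC point).
  have D0 : 0 <= D := le_trans (normr_ge0 _) (hD point).
  split => [|w]; first exact: addr_ge0.
  by rewrite (le_trans (hC w)) ?lerDl// (le_trans (hD w))// lerDr.
have [C hC] : {C : 'I_d -> 'I_d -> R | forall i j, b i j (C i j)}.
  exists (fun i j => xget 0 [set C | b i j C]) => i j.
  by have [C bC] := hb i j; have := xgetI 0 bC.
have C0 i j : 0 <= C i j by have [] := hC i j.
exists (\sum_i \sum_j C i j) => [|w i j].
  by do 2![apply: sumr_ge0 => ? _].
have CS : C i j <= \sum_i \sum_j C i j.
  rewrite (bigD1 i)//= [X in _ <= X + _](bigD1 j)//= -addrA lerDl.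
  by rewrite addr_ge0//; do ?[apply: sumr_ge0 => ? _].
by have [_ /(_ w)[h1 h2]] := hC i j; rewrite (le_trans h1)// (le_trans h2).
Qed.

Lemma bmx_mxexp th X : (forall w, X w \is hermsymmx) -> bmx X ->
  bmx (fun w => mxexp th (X w)).
Proof.
move=> hX bX i j.
have bT N : bmx (fun w => mxexp_trunc th N (X w)).
  apply: bmx_sum => k i' j'; under eq_fun do rewrite mxE.
  by apply: (cbmeasM (cbmeas_cst _)); exact: bmxX.
have [C C0 XC] := bmx_entries_le bX.
have [D XD] : exists D, forall w, entries_le D (mxexp th (X w)).
  pose L := 1 + \sum_(i < d) \sum_(j < d) (C ^+ 2 + C ^+ 2).
  exists (1 + \sum_(i < d) expR (`|th| * L) ^+ 2) => w.
  apply: mxfun_entries_le => [|k]; first exact: expR_ge0.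
  rewrite ger0_norm ?expR_ge0// ler_expR (le_trans (ler_norm _))// normrM.
  by rewrite ler_wpM2l// eigs_bounded.
split; split.
- apply: (measurable_fun_cvg (h := fun N w => complex.Re (mxexp_trunc th N (X w) i j))).
    by move=> N; exact: (bT N i j).1.1.
  by move=> w _; exact: cvg_Re_mxexp.
- by exists D => w; have [] := XD w i j.
- apply: (measurable_fun_cvg (h := fun N w => complex.Im (mxexp_trunc th N (X w) i j))).
    by move=> N; exact: (bT N i j).2.1.
  by move=> w _; exact: cvg_Im_mxexp.
- by exists D => w; have [] := XD w i j.
Qed.

End bounded_measurable_matrix.

(** * Exchangeable pairs *)

Section stein.
Context {R : realType} {d0 : measure_display} {T : measurableType d0} {d : nat}.
Variable P : probability T R.
Implicit Types (X Y : T -> 'M[R[i]]_d).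

Lemma le_Rintegral_linear (c a b : R) (f1 f2 f3 g1 g2 g3 g4 g5 g6 g7 : T -> R) :
  bmeas f1 -> bmeas f2 -> bmeas f3 ->
  bmeas g1 -> bmeas g2 -> bmeas g3 -> bmeas g4 ->
  bmeas g5 -> bmeas g6 -> bmeas g7 ->
  (forall w, a - f1 w - f2 w + f3 w <=
    c * (b - g1 w - g2 w + g3 w + g4 w - g5 w - g6 w + g7 w)) ->
  a - \int[P]_w f1 w - \int[P]_w f2 w + \int[P]_w f3 w <=
  c * (b - \int[P]_w g1 w - \int[P]_w g2 w + \int[P]_w g3 w + \int[P]_w g4 w
         - \int[P]_w g5 w - \int[P]_w g6 w + \int[P]_w g7 w).
Proof.
move=> bf1 bf2 bf3 bg1 bg2 bg3 bg4 bg5 bg6 bg7 le_fg.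
have ba (r : R) : bmeas (fun _ : T => r) := bmeas_cst r.
have bf := bmeasD (bmeasB (bmeasB (ba a) bf1) bf2) bf3.
have bg := bmeasD (bmeasB (bmeasB (bmeasD (bmeasD (bmeasB (bmeasB
  (ba b) bg1) bg2) bg3) bg4) bg5) bg6) bg7.
have := bmeas_le_Rintegral P bf (bmeasM (ba c) bg) le_fg.
rewrite (bmeas_RintegralZ P c bg).
rewrite (bmeas_RintegralD P (bmeasB (bmeasB (ba a) bf1) bf2) bf3).
rewrite (bmeas_RintegralB P (bmeasB (ba a) bf1) bf2).
rewrite (bmeas_RintegralB P (ba a) bf1).
rewrite (bmeas_RintegralD P (bmeasB (bmeasB (bmeasD (bmeasD (bmeasB (bmeasB
  (ba b) bg1) bg2) bg3) bg4) bg5) bg6) bg7).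
rewrite (bmeas_RintegralB P (bmeasB (bmeasD (bmeasD (bmeasB (bmeasB
  (ba b) bg1) bg2) bg3) bg4) bg5) bg6).
rewrite (bmeas_RintegralB P (bmeasD (bmeasD (bmeasB (bmeasB
  (ba b) bg1) bg2) bg3) bg4) bg5).
rewrite (bmeas_RintegralD P (bmeasD (bmeasB (bmeasB (ba b) bg1) bg2) bg3) bg4).
rewrite (bmeas_RintegralD P (bmeasB (bmeasB (ba b) bg1) bg2) bg3).
rewrite (bmeas_RintegralB P (bmeasB (ba b) bg1) bg2).
rewrite (bmeas_RintegralB P (ba b) bg1).
by rewrite !bmeas_Rintegral_cst.
Qed.

Lemma bmeas_rtrMl (M : 'M[R[i]]_d) X : bmx X -> bmeas (fun w => rtr (M *m X w)).
Proof. by move=> bX; apply: bmeas_rtr; exact: bmxMl. Qed.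

Lemma bmeas_rtrMr (M : 'M[R[i]]_d) X : bmx X -> bmeas (fun w => rtr (X w *m M)).
Proof. by move=> bX; apply: bmeas_rtr; exact: bmxMr. Qed.

Let E X := mx_expectation P X.

Lemma Rintegral_rtrMl (M : 'M[R[i]]_d) X : bmx X ->
  \int[P]_w rtr (M *m X w) = rtr (M *m mx_expectation P X).
Proof.
by move=> bX; rewrite (Rintegral_rtr P (bmxMl M bX)) mx_expectationMl.
Qed.

Lemma Rintegral_rtrMr (M : 'M[R[i]]_d) X : bmx X ->
  \int[P]_w rtr (X w *m M) = rtr (mx_expectation P X *m M).
Proof.
by move=> bX; rewrite (Rintegral_rtr P (bmxMr M bX)) mx_expectationMr.
Qed.

Lemma rtr0 : rtr (0 : 'M[R[i]]_d) = 0.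
Proof. by rewrite /rtr mxtrace0. Qed.

Lemma rtr_exchangeable_bound c (F G H N Q Y : T -> 'M[R[i]]_d) :
  bmx F -> bmx G -> bmx H -> bmx N -> bmx Q -> bmx Y -> E Y = 0 ->
  (forall w w', rtr (G w) - rtr (Y w *m F w') - rtr (F w *m Y w') + rtr (G w') <=
    c * (rtr (N w) - rtr (H w *m Y w') - rtr (G w *m Y w') + rtr (F w *m Q w')
      + rtr (Q w *m F w') - rtr (Y w *m G w') - rtr (Y w *m H w') + rtr (N w'))) ->
  rtr (E G) + rtr (E G) <=
  c * (rtr (E N) + rtr (E F *m E Q) + rtr (E Q *m E F) + rtr (E N)).
Proof.
move=> bF bG bH bN bQ bY EY0 le_ww'.
have le_w w : rtr (E G) - rtr (Y w *m E F) - 0 + rtr (G w) <=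
    c * (rtr (E N) - 0 - 0 + rtr (F w *m E Q)
      + rtr (Q w *m E F) - rtr (Y w *m E G) - rtr (Y w *m E H) + rtr (N w)).
  have := le_Rintegral_linear (bmeas_rtrMl (Y w) bF) (bmeas_rtrMl (F w) bY)
    (bmeas_rtr bG) (bmeas_rtrMl (H w) bY) (bmeas_rtrMl (G w) bY)
    (bmeas_rtrMl (F w) bQ) (bmeas_rtrMl (Q w) bF) (bmeas_rtrMl (Y w) bG)
    (bmeas_rtrMl (Y w) bH) (bmeas_rtr bN) (le_ww' w).
  rewrite (Rintegral_rtrMl (Y w) bF) (Rintegral_rtrMl (F w) bY)
    (Rintegral_rtr P bG) (Rintegral_rtrMl (H w) bY) (Rintegral_rtrMl (G w) bY)
    (Rintegral_rtrMl (F w) bQ) (Rintegral_rtrMl (Q w) bF) (Rintegral_rtrMl (Y w) bG)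
    (Rintegral_rtrMl (Y w) bH) (Rintegral_rtr P bN).
  rewrite -/(E Y) EY0 !mulmx0 rtr0 -/(E F) -/(E G) -/(E H) -/(E N) -/(E Q).
  move: (rtr _) (rtr _) (rtr _) (rtr _) (rtr _) (rtr _) (rtr _) (rtr _) => *; lra.
have b0 : bmeas (fun _ : T => 0 : R) := bmeas_cst 0.
have := le_Rintegral_linear (bmeas_rtrMr (E F) bY) b0
    (bmeas_rtr bG) b0 b0
    (bmeas_rtrMr (E Q) bF) (bmeas_rtrMr (E F) bQ) (bmeas_rtrMr (E G) bY)
    (bmeas_rtrMr (E H) bY) (bmeas_rtr bN) le_w.
rewrite (Rintegral_rtrMr (E F) bY)
    (Rintegral_rtr P bG)
    (Rintegral_rtrMr (E Q) bF) (Rintegral_rtrMr (E F) bQ) (Rintegral_rtrMr (E G) bY)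
    (Rintegral_rtrMr (E H) bY) (Rintegral_rtr P bN).
rewrite bmeas_Rintegral_cst -/(E Y) EY0 !mul0mx rtr0 -/(E F) -/(E G) -/(E H) -/(E N) -/(E Q).
rewrite !subr0; exact.
Qed.

Lemma trace_exchangeable_pair th (s : 'M[R[i]]_d) Y : 0 <= th ->
  s \is hermsymmx -> (forall w, Y w \is hermsymmx) -> bmx Y -> E Y = 0 ->
  \int[P]_w rtr (Y w *m mxexp th (s + Y w)) <=
  th / 2 * \int[P]_w rtr ((Y w ^+ 2 + E (fun w => Y w ^+ 2)) *m mxexp th (s + Y w)).
Proof.
move=> th0 hs hY bY EY0; pose F w := mxexp th (s + Y w).
have hsY w : s + Y w \is hermsymmx := hermsymmxD hs (hY w).
have bF : bmx F := bmx_mxexp th hsY (bmxD (bmx_cst s) bY).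
pose Q w := Y w *m Y w; have bQ : bmx Q := bmxM bY bY.
pose G w := Y w *m F w; have bG : bmx G := bmxM bY bF.
pose H w := F w *m Y w; have bH : bmx H := bmxM bF bY.
pose N w := Q w *m F w; have bN : bmx N := bmxM bQ bF.
have Qsqr : (fun w => Y w ^+ 2) = Q by [].
rewrite Qsqr.
have := @rtr_exchangeable_bound (th / 2) F G H N Q Y bF bG bH bN bQ bY EY0.
have -> : \int[P]_w rtr ((Y w ^+ 2 + E Q) *m mxexp th (s + Y w)) =
    rtr (E N) + rtr (E Q *m E F).
  have bV := bmxMl (E Q) bF.
  rewrite -(Rintegral_rtrMl (E Q) bF) -(Rintegral_rtr P bN).
  rewrite -(bmeas_RintegralD P (bmeas_rtr bN) (bmeas_rtrMl (E Q) bF)).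
  by congr (Rintegral P _ _); apply/funext => w; rewrite -rtrD -mulmxDl.
rewrite (Rintegral_rtr P bG) (rtr_mulC (E F)) => h.
suff : rtr (E G) + rtr (E G) <=
   th / 2 * (rtr (E N) + rtr (E Q *m E F) + rtr (E Q *m E F) + rtr (E N)).
  move: (th / 2) (rtr _) (rtr _) (rtr _) => c x y z; lra.
apply: h => w w'.
have := tr_exp_mean_value th0 (hsY w) (hsY w').
have -> : s + Y w - (s + Y w') = Y w - Y w' by rewrite opprD addrACA subrr add0r.
rewrite -/(F w) -/(F w').
have t1 : rtr (Y w *m Y w' *m F w) = rtr (H w *m Y w').
  by rewrite rtr_mulC mulmxA.
have t2 : rtr (Y w' *m Y w *m F w) = rtr (G w *m Y w').
  by rewrite -mulmxA rtr_mulC.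
have t3 : rtr (Y w' *m Y w' *m F w) = rtr (F w *m Q w') by rewrite rtr_mulC.
have t4 : rtr (Y w *m Y w' *m F w') = rtr (Y w *m G w') by rewrite -mulmxA.
have t5 : rtr (Y w' *m Y w *m F w') = rtr (Y w *m H w').
  by rewrite -mulmxA rtr_mulC -mulmxA.
rewrite (rtr_sub_sqr (erefl _) t1 t2 t3 (erefl _) t4 t5 (erefl _)).
rewrite rtr_sub_mul (rtr_mulC (Y w') (F w)).
rewrite -/(G w) -/(G w') -/(Q w) -/(N w) -/(Q w') -/(N w').
move: (rtr _) (rtr _) (rtr _) (rtr _) => x1 x2 x3 x4.
move: (rtr _) (rtr _) (rtr _) (rtr _) (rtr _) (rtr _) (rtr _) (rtr _) => y1 y2 y3 y4 y5 y6 y7 y8 h.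
by apply: le_trans (le_trans _ h) _; rewrite le_eqVlt; apply/orP; left;
  apply/eqP; ring.
Qed.

End stein.

(** * Independence *)

Lemma bmx_comp (R : realType) (d1 d2 : measure_display) (T1 : measurableType d1)
    (T2 : measurableType d2) (d : nat) (phi : T1 -> T2) (X : T2 -> 'M[R[i]]_d) :
  measurable_fun setT phi -> bmx X -> bmx (X \o phi).
Proof.
by move=> mphi bX i j; split; [exact: (bmeas_comp mphi (bX i j).1)|
  exact: (bmeas_comp mphi (bX i j).2)].
Qed.

Section independence.
Context {R : realType} {d0 : measure_display} {T : measurableType d0}.
Variable P : probability T R.

Lemma indep_g_sigma_algebra_l (G : set (set T)) (B : set T) :
  G `<=` measurable -> setI_closed G -> G setT -> measurable B ->
  (forall A, G A -> P (A `&` B) = P A * P B)%E ->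
  forall A, <<s G >> A -> (P (A `&` B) = P A * P B)%E.
Proof.
move=> Gm GI GT mB GB A GA.
pose r : {nonneg R} := NngNum (fine_ge0 (measure_ge0 P B)).
have rE : r%:num%:E = P B by rewrite /= fineK// fin_num_measure.
suff : mrestr P mB A = mscale r P A by rewrite /mrestr /mscale rE muleC.
apply: (@g_sigma_algebra_measure_unique _ _ _ G Gm (fun=> setT)) => //.
- by rewrite bigcup_const.
- by move=> C GC; rewrite /= /mrestr /mscale rE muleC; exact: GB.
- move=> _; rewrite /= /mrestr; apply: le_lt_trans (ltry 1).
  by apply: probability_le1; exact: measurableI.
Qed.

Lemma indep_g_sigma_algebra (G H : set (set T)) :
  G `<=` measurable -> setI_closed G -> G setT ->
  H `<=` measurable -> setI_closed H -> H setT ->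
  (forall A B, G A -> H B -> P (A `&` B) = P A * P B)%E ->
  forall A B, <<s G >> A -> <<s H >> B -> (P (A `&` B) = P A * P B)%E.
Proof.
move=> Gm GI GT Hm HI HT GH A B GA HB.
have mA : measurable A by apply: (smallest_sub (@sigma_algebra_measurable _ T) Gm).
rewrite setIC muleC; apply: (indep_g_sigma_algebra_l Hm HI HT mA _ HB) => C HC.
rewrite setIC muleC; apply: (indep_g_sigma_algebra_l Gm GI GT (Hm _ HC) _ GA).
by move=> D GD; exact: GH.
Qed.

Lemma fubini_indep (d1 d2 : measure_display) (T1 : measurableType d1)
    (T2 : measurableType d2) (X1 : {mfun T >-> T1}) (X2 : {mfun T >-> T2})
    (f : T1 * T2 -> R) :
  (forall A B, measurable A -> measurable B ->
    P (X1 @^-1` A `&` X2 @^-1` B) = P (X1 @^-1` A) * P (X2 @^-1` B))%E ->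
  bmeas f ->
  bmeas (fun w => \int[P]_w' f (X1 w, X2 w')) /\
  \int[P]_w f (X1 w, X2 w) = \int[P]_w \int[P]_w' f (X1 w, X2 w').
Proof.
move=> X12 bf.
have mX12 : measurable_fun setT (fun w => (X1 w, X2 w)).
  by apply: measurable_fun_pair; exact: measurable_funP.
pose X12' : {mfun T >-> (T1 * T2)%type} := mfun_Sub (mem_set mX12).
pose P1 := distribution P X1; pose P2 := distribution P X2.
pose P12 := distribution P X12'.
have P12E A : measurable A -> (P1 \x P2)%E A = P12 A.
  by apply: product_measure_unique => C D mC mD; exact: X12.
have if1x2 : (P1 \x P2)%E.-integrable setT (EFin \o f).
  have [mf [C fC]] := bf; apply: measurable_bounded_integrable => //.
    have /= -> := P12E _ measurableT.
    exact: le_lt_trans (probability_le1 P12 measurableT) (ltry _).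
  by exists C; split => [|x Cx w _]; [exact: num_real|exact: le_trans (fC w) (ltW Cx)].
pose F := fubini_F P2 (EFin \o f).
have bfx x : bmeas (fun w' => f (x, X2 w')).
  have mx : measurable_fun setT (fun w' => (x, X2 w')).
    by apply: measurable_fun_pair => //; exact: measurable_funP.
  exact: (bmeas_comp mx bf).
have FE x : F x = (\int[P]_w' f (x, X2 w'))%:E.
  rewrite -bmeas_RintegralE// /F /fubini_F.
  have mfx : measurable_fun setT (fun y => (f (x, y))%:E).
    apply/measurable_EFinP/(measurableT_comp bf.1).
    by apply: measurable_fun_pair.
  by rewrite [LHS](integral_pushforward (measurable_funP X2) mfx)//;
    exact: (bmeas_integrable P (bfx x)).
have mF : measurable_fun setT F := measurable_fubini_F if1x2.
have bG : bmeas (fun w => \int[P]_w' f (X1 w, X2 w')).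
  split.
    apply/measurable_EFinP; rewrite (_ : _ \o _ = F \o X1); last first.
      by apply/funext => w; rewrite /= FE.
    by apply: measurableT_comp => //; exact: measurable_funP.
  have [mf [C fC]] := bf; exists C => w.
  apply: le_trans (le_normr_Rintegral _ (bmeas_integrable P (bfx _))) _ => //.
  rewrite -[leRHS](bmeas_Rintegral_cst P).
  apply: bmeas_le_Rintegral => //; last exact: bmeas_cst.
  split; first exact: measurableT_comp (bfx _).1.
  by exists C => w'; rewrite normr_id.
split => //; apply: EFin_inj.
rewrite -[RHS]bmeas_RintegralE//.
have bfX : bmeas (fun w => f (X1 w, X2 w)) by exact: (bmeas_comp mX12 bf).
rewrite -[LHS]bmeas_RintegralE//.
transitivity (\int[P12]_z (f z)%:E)%E.
  apply/esym; rewrite [LHS](integral_pushforward mX12)//.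
    by apply/measurable_EFinP; have [] := bf.
  exact: (bmeas_integrable P bfX).
transitivity (\int[P1 \x P2]_z (f z)%:E)%E.
  by apply: eq_measure_integral => A mA _; exact/esym/P12E.
rewrite -[LHS](integral12_prod_meas1 if1x2).
rewrite [LHS](integral_pushforward (measurable_funP X1) mF)//.
  by apply: eq_integral => w _; rewrite /= -/F FE.
by apply: eq_integrable (bmeas_integrable P bG) => // w _; rewrite /= FE.
Qed.

End independence.

HB.instance Definition _ (R : realType) := isPointed.Build R[i] 0.

Definition mx_entry_events (R : realType) (d : nat) : set (set 'M[R[i]]_d) :=
  \bigcup_(ij in [set: 'I_d * 'I_d])
    (preimage_set_system setT
       (fun M : 'M[R[i]]_d => complex.Re (M ij.1 ij.2)) measurable `|`
     preimage_set_system setT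
       (fun M : 'M[R[i]]_d => complex.Im (M ij.1 ij.2)) measurable).

Section random_matrices.
Context {R : realType} {d : nat}.

Lemma mx_borelI (A B : set 'M[R[i]]_d) : mx_borel A -> mx_borel B -> mx_borel (A `&` B).
Proof. exact: (@measurableI _ (g_sigma_algebraType (@mx_entry_events R d))). Qed.

Lemma mx_borelT : mx_borel [set: 'M[R[i]]_d].
Proof. exact: (@measurableT _ (g_sigma_algebraType (@mx_entry_events R d))). Qed.

Lemma random_mxP {d0 : measure_display} {T : measurableType d0} (X : T -> 'M[R[i]]_d) :
  random_mx X <-> forall i j, measurable_fun setT (fun w => complex.Re (X w i j)) /\
    measurable_fun setT (fun w => complex.Im (X w i j)).
Proof.
split => [mX i j|mX].
  split => _ B mB; rewrite setTI.
    apply: (mX [set M | B (complex.Re (M i j))]); apply: sub_sigma_algebra.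
    by exists (i, j) => //; left; exists B => //; rewrite setTI.
  apply: (mX [set M | B (complex.Im (M i j))]); apply: sub_sigma_algebra.
  by exists (i, j) => //; right; exists B => //; rewrite setTI.
have mX' : measurable_fun setT (X : T -> g_sigma_algebraType (@mx_entry_events R d)).
  pose M := g_sigma_algebraType (@mx_entry_events R d).
  apply: (@measurability _ _ T M _ _ (@mx_entry_events R d)) => // _ [_ [[i j] _ []] [B mB <-] <-].
    by have [/(_ measurableT B mB)] := mX i j; rewrite !setTI.
  by have [_ /(_ measurableT B mB)] := mX i j; rewrite !setTI.
by move=> B mB; rewrite -[_ @^-1` _]setTI; exact: mX'.
Qed.

Lemma random_mx_bmx {d0 : measure_display} {T : measurableType d0}
    (X : T -> 'M[R[i]]_d) C :
  random_mx X -> (forall w, entries_le C (X w)) -> bmx X.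
Proof.
move=> /random_mxP mX XC i j; have [m1 m2] := mX i j.
by split; split => //; exists C => w; have [] := XC w i j.
Qed.

End random_matrices.

Section independent_matrices.
Context {R : realType} {d0 : measure_display} {T : measurableType d0} {d n : nat}.
Variable P : probability T R.
Variables (Y : 'I_n -> T -> 'M[R[i]]_d) (C : R).
Hypotheses (mY : forall k, random_mx (Y k)) (hY : forall k w, Y k w \is hermsymmx)
  (iY : mutually_independent P Y) (bY : forall k w, entries_le C (Y k w)).

Variable k : 'I_n.

Definition others_events : set (set T) := [set A | exists2 B : 'I_n -> set 'M[R[i]]_d,
  (forall j, mx_borel (B j)) & A = \bigcap_(j in [set` [set~ k]%SET]) (Y j @^-1` B j)].

Definition self_events : set (set T) :=
  [set A | exists2 B : set 'M[R[i]]_d, mx_borel B & A = Y k @^-1` B].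

Lemma others_self_indep A B : others_events A -> self_events B ->
  (P (A `&` B) = P A * P B)%E.
Proof.
move=> [C1 mC1 ->] [C2 mC2 ->].
pose C3 j := if j == k then C2 else C1 j.
have mC3 j : mx_borel (C3 j) by rewrite /C3; case: ifP.
have -> : \bigcap_(j in [set` [set~ k]%SET]) (Y j @^-1` C1 j) `&` Y k @^-1` C2 =
    \bigcap_(j in [set` [set: 'I_n]%SET]) (Y j @^-1` C3 j).
  apply/seteqP; split => w /=.
    move=> [h1 h2] j _; rewrite /C3; case: eqP => [->//|/eqP jk].
    by apply: h1; rewrite /= !inE.
  move=> h; split => [j /=|]; last by have := h k; rewrite /C3 eqxx; apply; rewrite /= inE.
  rewrite !inE => jk; have := h j; rewrite /C3 (negbTE jk); apply.
  by rewrite /= inE.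
rewrite !iY// (bigD1 k) ?inE//= /C3 eqxx muleC; congr (_ * _)%E.
by apply: eq_big => [j|j]; rewrite !inE// => /negbTE ->.
Qed.

Lemma others_measurable : others_events `<=` measurable.
Proof.
move=> _ [B mB ->]; apply: fin_bigcap_measurable; first exact: finite_finset.
by move=> j _; exact: mY.
Qed.

Lemma self_measurable : self_events `<=` measurable.
Proof. by move=> _ [B mB ->]; exact: mY. Qed.

Lemma others_setI : setI_closed others_events.
Proof.
move=> _ _ [A mA ->] [B mB ->]; exists (fun j => A j `&` B j).
  by move=> j; exact: mx_borelI.
by rewrite -bigcapI; apply: eq_bigcapr => j _; rewrite preimage_setI.
Qed.

Lemma self_setI : setI_closed self_events.
Proof.
move=> _ _ [A mA ->] [B mB ->]; exists (A `&` B); first exact: mx_borelI.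
by rewrite preimage_setI.
Qed.

Lemma others_setT : others_events setT.
Proof.
exists (fun=> setT) => [j|]; first exact: mx_borelT.
by rewrite bigcapT.
Qed.

Lemma self_setT : self_events setT.
Proof. by exists setT; [exact: mx_borelT|]. Qed.

Lemma random_mx_others j : j != k ->
  random_mx (Y j : g_sigma_algebraType others_events -> 'M[R[i]]_d).
Proof.
move=> jk B mB; apply: sub_sigma_algebra.
exists (fun l => if l == j then B else setT) => [l|].
  by case: eqP => // _; exact: mx_borelT.
apply/seteqP; split => [w Bw l _ /=|w]; first by case: eqP => [->|].
by move=> /(_ j); rewrite /= !inE eqxx; apply.
Qed.

Lemma random_mx_self :
  random_mx (Y k : g_sigma_algebraType self_events -> 'M[R[i]]_d).
Proof. by move=> B mB; apply: sub_sigma_algebra; exists B. Qed.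

Lemma mfun_id_g_sigma (G : set (set T)) : G `<=` measurable ->
  measurable_fun setT (id : T -> g_sigma_algebraType G).
Proof.
move=> Gm _ B GB; rewrite setTI.
exact: (smallest_sub (@sigma_algebra_measurable _ T) Gm).
Qed.

Lemma fubini_self_others (f : T * T -> R) :
  @bmeas R _ (g_sigma_algebraType others_events * g_sigma_algebraType self_events)%type f ->
  bmeas (fun w => \int[P]_w' f (w, w')) /\
  \int[P]_w f (w, w) = \int[P]_w \int[P]_w' f (w, w').
Proof.
move=> bf.
pose X1 : {mfun T >-> g_sigma_algebraType others_events} :=
  mfun_Sub (mem_set (mfun_id_g_sigma others_measurable)).
pose X2 : {mfun T >-> g_sigma_algebraType self_events} :=
  mfun_Sub (mem_set (mfun_id_g_sigma self_measurable)).
apply: (@fubini_indep _ _ _ P _ _ _ _ X1 X2 f _ bf) => A B.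
exact: (indep_g_sigma_algebra others_measurable others_setI others_setT
  self_measurable self_setI self_setT others_self_indep).
Qed.

Lemma trace_exp_summand th (V := mx_expectation P (fun w => Y k w ^+ 2)) :
  0 <= th -> mx_expectation P (Y k) = 0 ->
  \int[P]_w rtr (Y k w *m mxexp th (\sum_j Y j w)) <=
  th / 2 * \int[P]_w rtr ((Y k w ^+ 2 + V) *m mxexp th (\sum_j Y j w)).
Proof.
move=> th0 EY0.
pose T1 : measurableType _ := g_sigma_algebraType others_events.
pose T2 : measurableType _ := g_sigma_algebraType self_events.
pose T12 : measurableType _ := (T1 * T2)%type.
pose S (w : T1) := \sum_(j | j != k) Y j w.
pose Y2 (w : T2) := Y k w.
have bmY j : bmx (Y j) := random_mx_bmx (mY j) (bY j).
have bS : bmx S.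
  rewrite /S => i j; pose Z l (w : T1) := if l != k then Y l w else 0.
  have bZ l : bmx (Z l).
    rewrite /Z; case: (eqVneq l k) => [_|lk]; first exact: bmx_cst.
    exact: random_mx_bmx (random_mx_others lk) (bY l).
  have := bmx_sum (index_enum 'I_n) xpredT bZ i j.
  congr (cbmeas _); apply/funext => w; congr (fun_of_matrix _ i j).
  by rewrite [RHS]big_mkcond.
have bY2 : bmx Y2 := random_mx_bmx random_mx_self (bY k).
have hS w : S w \is hermsymmx by exact: hermsymmx_sum.
have b1 : bmx (fun z : T12 => Y2 z.2) := bmx_comp measurable_snd bY2.
have bS1 : bmx (fun z : T12 => S z.1) := bmx_comp measurable_fst bS.
have bE : bmx (fun z : T12 => mxexp th (S z.1 + Y2 z.2)).
  have hH (z : T12) : S z.1 + Y2 z.2 \is hermsymmx := hermsymmxD (hS z.1) (hY k z.2).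
  have bH : bmx (fun z : T12 => S z.1 + Y2 z.2) := bmxD bS1 b1.
  exact: (bmx_mxexp th hH bH).
pose f1 (z : T12) := rtr (Y2 z.2 *m mxexp th (S z.1 + Y2 z.2)).
pose f2 (z : T12) := rtr ((Y2 z.2 ^+ 2 + V) *m mxexp th (S z.1 + Y2 z.2)).
have bf1 : bmeas f1 := bmeas_rtr (bmxM b1 bE).
have bf2 : bmeas f2 := bmeas_rtr (bmxM (bmxD (bmxX 2 b1) (bmx_cst V)) bE).
have [bi1 if1] := fubini_self_others bf1.
have [bi2 if2] := fubini_self_others bf2.
have SE w : \sum_j Y j w = S w + Y2 w by rewrite (bigD1 k)//= addrC.
have E1 : \int[P]_w rtr (Y k w *m mxexp th (\sum_j Y j w)) = \int[P]_w f1 (w, w).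
  by apply: eq_Rintegral => w _; rewrite SE.
have E2 : \int[P]_w rtr ((Y k w ^+ 2 + V) *m mxexp th (\sum_j Y j w)) =
    \int[P]_w f2 (w, w).
  by apply: eq_Rintegral => w _; rewrite SE.
rewrite [leLHS]E1 [X in _ <= _ * X]E2 [leLHS]if1 [X in _ <= _ * X]if2.
rewrite -(bmeas_RintegralZ P (th / 2) bi2).
apply: (bmeas_le_Rintegral P bi1 (bmeasM (bmeas_cst (th / 2)) bi2)) => w.
exact: (trace_exchangeable_pair th0 (hS w) (hY k) (bmY k) EY0).
Qed.

End independent_matrices.

(** * Moment generating function *)

Lemma expR_le_1B (R : realType) (x : R) : 0 <= x <= 2^-1 ->
  expR (- (x + 2 * x ^+ 2)) <= 1 - x.
Proof.
move=> /andP[x0 x2]; rewrite expRN.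
have e1 : 1 + (x + 2 * x ^+ 2) <= expR (x + 2 * x ^+ 2) by exact: expR_ge1Dx.
have e0 := expR_gt0 (x + 2 * x ^+ 2).
rewrite -[leLHS]mul1r ler_pdivrMr//.
have : (1 - x) * (1 + (x + 2 * x ^+ 2)) <= (1 - x) * expR (x + 2 * x ^+ 2).
  by rewrite ler_wpM2l//; lra.
apply: le_trans.
have -> : (1 - x) * (1 + (x + 2 * x ^+ 2)) = 1 + x ^+ 2 * (1 - 2 * x) by ring.
by rewrite lerDl mulr_ge0 ?sqr_ge0//; lra.
Qed.

(* On a subdivision of [0, th] into steps of length h, going from y - h to y
   multiplies m by at most 1 / (1 - h * y * v); refining the subdivision turns the
   product of these factors into the exponential. *)
Lemma discrete_gronwall (R : realType) (m : R -> R) (v th : R) :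
  0 <= v -> 0 <= th -> (forall x, 0 <= m x) ->
  (forall x y, 0 <= x <= y -> m y - m x <= (y - x) * (y * v * m y)) ->
  m th <= m 0 * expR (v * th ^+ 2 / 2).
Proof.
move=> v0 th0 m0 hm.
pose c := v * th ^+ 2; have c0 : 0 <= c by rewrite mulr_ge0 ?sqr_ge0.
have step (N : nat) : 2 * c <= N.+1%:R -> forall j, (j <= N.+1)%N ->
    m (th * (j%:R / N.+1%:R)) <= m 0 * expR (c * (j%:R * (j%:R + 1)) / (2 * N.+1%:R ^+ 2)
       + j%:R * (2 * (c / N.+1%:R) ^+ 2)).
  move=> cN; have N0 : 0 < N.+1%:R :> R by rewrite ltr0n.
  move: (N.+1%:R : R) N0 cN (fun j => ler_nat R j N.+1) => r r0 cr leN.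
  elim=> [_|j IH jN]; first by rewrite !mul0r !mulr0 mul0r addr0 expR0 mulr1.
  have {}IH := IH (ltnW jN).
  pose x := c * j.+1%:R / r ^+ 2.
  have jr : j.+1%:R / r <= 1 by rewrite ler_pdivrMr// mul1r leN.
  have j0 : 0 <= j.+1%:R :> R by [].
  have cr0 : 0 <= c / r by rewrite divr_ge0// ltW.
  have xcr : x <= c / r.
    have -> : x = c / r * (j.+1%:R / r) by rewrite /x; field; rewrite gt_eqF.
    by rewrite ler_piMr.
  have x0 : 0 <= x by rewrite /x divr_ge0 ?sqr_ge0 ?mulr_ge0.
  have x2 : x <= 2^-1.
    by apply: le_trans xcr _; rewrite ler_pdivrMr//; lra.
  have := hm (th * (j%:R / r)) (th * (j.+1%:R / r)).
  have -> : 0 <= th * (j%:R / r) <= th * (j.+1%:R / r).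
    rewrite mulr_ge0 ?divr_ge0 ?(ltW r0)//= ler_wpM2l// ler_pM2r ?invr_gt0//.
    by rewrite ler_nat.
  move=> /(_ isT).
  have -> : (th * (j.+1%:R / r) - th * (j%:R / r)) *
      (th * (j.+1%:R / r) * v * m (th * (j.+1%:R / r))) = x * m (th * (j.+1%:R / r)).
    by rewrite /x /c -natr1; field; rewrite gt_eqF.
  move: (m (th * (j.+1%:R / r))) (m0 (th * (j.+1%:R / r))) => mj mj0 hj.
  have {hj} : mj * (1 - x) <= m (th * (j%:R / r)) by lra.
  move=> /le_trans/(_ IH) hj.
  have e1 : mj * expR (- (x + 2 * x ^+ 2)) <= mj * (1 - x).
    by rewrite ler_wpM2l// expR_le_1B// x0.
  have := le_trans e1 hj; rewrite expRN ler_pdivrMr ?expR_gt0// -(mulrA (m 0)) -expRD.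
  move=> /le_trans; apply; rewrite ler_wpM2l// ler_expR.
  have -> : c * (j.+1%:R * (j.+1%:R + 1)) / (2 * r ^+ 2) + j.+1%:R * (2 * (c / r) ^+ 2)
     = c * (j%:R * (j%:R + 1)) / (2 * r ^+ 2) + j%:R * (2 * (c / r) ^+ 2) + (x + 2 * (c / r) ^+ 2).
    by rewrite /x -natr1; field; rewrite gt_eqF.
  by rewrite lerD2l lerD2l ler_wpM2l// lerXn2r// nnegrE.
apply/ler_addgt0Pr => e e0.
pose a := m 0 * expR (v * th ^+ 2 / 2).
have a0 : 0 <= a by rewrite mulr_ge0 ?expR_ge0.
pose K := c / 2 + 2 * c ^+ 2.
have K0 : 0 <= K by rewrite addr_ge0 ?divr_ge0 ?mulr_ge0 ?sqr_ge0.
have mt0 := m0 th.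
have [N hN] : exists N : nat, 2 * c + K * m th / e + 1 <= N.+1%:R.
  pose z := 2 * c + K * m th / e + 1.
  exists (Num.truncn z); exact: ltW (truncnS_gt z).
have N0 : 0 < N.+1%:R :> R by rewrite ltr0n.
have q0 : 0 <= K * m th / e by rewrite divr_ge0 ?mulr_ge0 // ltW.
have := step N _ N.+1 (leqnn _); rewrite divff ?gt_eqF// mulr1.
have -> : c * (N.+1%:R * (N.+1%:R + 1)) / (2 * N.+1%:R ^+ 2) +
    N.+1%:R * (2 * (c / N.+1%:R) ^+ 2) = v * th ^+ 2 / 2 + K / N.+1%:R.
  by rewrite /K /c; field; rewrite gt_eqF.
rewrite expRD mulrA -/a => /(_ _)h.
have {h} : m th <= a * expR (K / N.+1%:R) by apply: h; lra.
rewrite -ler_pdivrMr ?expR_gt0// -expRN => h.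
have e1 := expR_ge1Dx (- (K / N.+1%:R)).
have e2 : m th * (1 - K / N.+1%:R) <= a.
  by apply: le_trans h; rewrite ler_wpM2l.
have e3 : m th * (K / N.+1%:R) <= e.
  have : K * m th / e <= N.+1%:R by lra.
  by rewrite ler_pdivrMr// mulrA ler_pdivrMr//; lra.
rewrite -/a; move: e2 e3; rewrite mulrBr mulr1 => e2 e3.
by rewrite -lerBlDr (le_trans _ e2)// lerD2l lerN2.
Qed.

Section bounded_summands.
Context {R : realType} {d0 : measure_display} {T : measurableType d0} {d n : nat}.
Variable P : probability T R.
Variables (Y : 'I_n -> T -> 'M[R[i]]_d) (A : 'I_n -> 'M[R[i]]_d) (C sigma : R).
Hypotheses (d_gt0 : (0 < d)%N) (mY : forall k, random_mx (Y k))
  (hY : forall k w, Y k w \is hermsymmx)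
  (iY : mutually_independent P Y) (bY : forall k w, entries_le C (Y k w))
  (hA : forall k, A k \is hermsymmx) (EY0 : forall k, mx_expectation P (Y k) = 0)
  (YA : forall k, {ae P, forall w, loewner_le (Y k w ^+ 2) (A k ^+ 2)})
  (sigmaE : sigma ^+ 2 = 2^-1 * spectral_norm
     (\sum_(k < n) (A k ^+ 2 + mx_expectation P (fun w => Y k w ^+ 2)))).

Let X w := \sum_k Y k w.
Let V k := mx_expectation P (fun w => Y k w ^+ 2).
Let M := \sum_k (A k ^+ 2 + V k).

Lemma bmeas_Rintegral_sum (I : Type) (r : seq I) (F : I -> T -> R) :
  (forall i, bmeas (F i)) -> bmeas (fun w => \sum_(i <- r) F i w) /\
  \int[P]_w (\sum_(i <- r) F i w) = \sum_(i <- r) \int[P]_w F i w.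
Proof.
move=> bF; elim: r => [|i r [IH1 IH2]].
  have -> : (fun w => \sum_(i <- [::]) F i w) = cst 0.
    by apply/funext => w; rewrite big_nil.
  by rewrite big_nil; split; [exact: bmeas_cst|exact: bmeas_Rintegral_cst].
have -> : (fun w => \sum_(j <- i :: r) F j w) = (fun w => F i w + \sum_(j <- r) F j w).
  by apply/funext => w; rewrite big_cons.
by rewrite big_cons -IH2; split; [exact: bmeasD|exact: bmeas_RintegralD].
Qed.

Lemma mx_expectation_herm (Z : T -> 'M[R[i]]_d) :
  bmx Z -> (forall w, Z w \is hermsymmx) -> mx_expectation P Z \is hermsymmx.
Proof.
move=> bZ hZ; apply/hermsymmxP; rewrite mx_expectationE; apply/matrixP => i j.
rewrite !mxE; have ZE w : Z w i j = (Z w j i)^*.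
  by have /hermsymmxP {1}<- := hZ w; rewrite !mxE.
rewrite /cexp; under [in RHS]eq_Rintegral do rewrite ZE.
under [X in _ = _ +i* X]eq_Rintegral do rewrite ZE.
have -> : \int[P]_w complex.Im (Z w j i)^* = - \int[P]_w complex.Im (Z w j i).
  rewrite -mulN1r -bmeas_RintegralZ; last exact: (bZ j i).2.
  by apply: eq_Rintegral => w _; case: (Z w j i) => a b /=; rewrite mulN1r.
have -> : \int[P]_w complex.Re (Z w j i)^* = \int[P]_w complex.Re (Z w j i).
  by apply: eq_Rintegral => w _; case: (Z w j i).
by [].
Qed.

Let bmY k : bmx (Y k). Proof. exact: random_mx_bmx (mY k) (bY k). Qed.

Let bX : bmx X. Proof. exact: (bmx_sum (index_enum 'I_n) xpredT bmY). Qed.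

Let hX w : X w \is hermsymmx. Proof. exact: hermsymmx_sum. Qed.

Let bE th : bmx (fun w => mxexp th (X w)). Proof. exact: bmx_mxexp. Qed.

Let hM : M \is hermsymmx.
Proof.
apply: hermsymmx_sum => k; apply: hermsymmxD; first exact: hermsymmx_sqr.
by apply: mx_expectation_herm => [|w]; [exact: bmxX|exact: hermsymmx_sqr].
Qed.

Lemma trace_exp_drift th : 0 <= th ->
  \int[P]_w rtr (X w *m mxexp th (X w)) <=
  th * sigma ^+ 2 * \int[P]_w rtr (mxexp th (X w)).
Proof.
move=> th0.
have b1 k : bmeas (fun w => rtr (Y k w *m mxexp th (X w))).
  exact: bmeas_rtr (bmxM (bmY k) (bE th)).
have b2 k : bmeas (fun w => rtr ((Y k w ^+ 2 + V k) *m mxexp th (X w))).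
  exact: bmeas_rtr (bmxM (bmxD (bmxX 2 (bmY k)) (bmx_cst (V k))) (bE th)).
have [_ s1] := bmeas_Rintegral_sum (index_enum 'I_n) b1.
have [bs2 s2] := bmeas_Rintegral_sum (index_enum 'I_n) b2.
have -> : \int[P]_w rtr (X w *m mxexp th (X w)) =
    \sum_k \int[P]_w rtr (Y k w *m mxexp th (X w)).
  by rewrite -s1; apply: eq_Rintegral => w _; rewrite -rtr_sum -mulmx_suml.
apply: (@le_trans _ _ (th / 2 * \sum_k \int[P]_w
    rtr ((Y k w ^+ 2 + V k) *m mxexp th (X w)))).
  rewrite mulr_sumr; apply: ler_sum => k _.
  exact: (trace_exp_summand mY hY iY bY).
have -> : th * sigma ^+ 2 = th / 2 * spectral_norm M.
  by rewrite sigmaE -/M mulrA.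
rewrite -[leRHS]mulrA -(bmeas_RintegralZ P (spectral_norm M) (bmeas_rtr (bE th))).
rewrite ler_wpM2l ?divr_ge0// -s2.
have b3 : bmeas (fun w => spectral_norm M * rtr (mxexp th (X w))).
  exact: (bmeasM (bmeas_cst _) (bmeas_rtr (bE th))).
apply: bmeas_ae_le_Rintegral => //.
have aeA : {ae P, forall w, forall k, loewner_le (Y k w ^+ 2) (A k ^+ 2)}.
  exact: (@filter_forall _ _ (fun k => [set w | loewner_le (Y k w ^+ 2) (A k ^+ 2)])).
apply: filterS aeA => w Yw.
apply: (@le_trans _ _ (rtr (M *m mxexp th (X w)))).
  rewrite mulmx_suml rtr_sum; apply: ler_sum => k _.
  rewrite -subr_ge0 -rtrB -mulmxBl opprD addrACA subrr addr0.
  by apply: rtr_psdmx_mul_ge0 => [|x]; [exact: Yw|exact: expR_ge0].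
rewrite -{1}(mxfun_id hM); apply: rtr_mxfunM_le => [i|x]; last exact: expR_ge0.
exact: eigs_le_spectral_norm.
Qed.

Lemma rtr_mxexp_convex (x y : R) (H : 'M[R[i]]_d) : x <= y -> H \is hermsymmx ->
  rtr (mxexp y H) - rtr (mxexp x H) <= (y - x) * rtr (H *m mxexp y H).
Proof.
move=> xy hH.
have -> : rtr (H *m mxexp y H) = rtr (mxfun (id \* (fun t => expR (y * t))) H).
  by rewrite -mxfunM mxfun_id.
rewrite !rtr_mxfun -sumrB mulr_sumr; apply: ler_sum => i _ /=.
set l := eigs H i.
have -> : expR (x * l) = expR (y * l) * expR ((x - y) * l).
  by rewrite -expRD; congr expR; ring.
have := ler_wpM2l (expR_ge0 (y * l)) (expR_ge1Dx ((x - y) * l)); lra.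
Qed.

Lemma trace_mgf_bound th : 0 <= th ->
  \int[P]_w rtr (mxexp th (X w)) <= d%:R * expR (sigma ^+ 2 * th ^+ 2 / 2).
Proof.
move=> th0; pose m th := \int[P]_w rtr (mxexp th (X w)).
have m_ge0 x : 0 <= m x.
  apply: Rintegral_ge0 => w _; rewrite rtr_mxfun.
  by apply: sumr_ge0 => i _; exact: expR_ge0.
have -> : d%:R = m 0.
  rewrite /m -[LHS](bmeas_Rintegral_cst P); apply: eq_Rintegral => w _.
  rewrite rtr_mxfun; under eq_bigr do rewrite mul0r expR0.
  by rewrite sumr_const card_ord.
apply: discrete_gronwall => // [|x y /andP[x0 xy]]; first exact: sqr_ge0.
have bm t : bmeas (fun w => rtr (mxexp t (X w))) by exact: bmeas_rtr.
have bXm : bmeas (fun w => rtr (X w *m mxexp y (X w))).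
  exact: bmeas_rtr (bmxM bX (bE y)).
rewrite -bmeas_RintegralB//.
apply: (@le_trans _ _ ((y - x) * \int[P]_w rtr (X w *m mxexp y (X w)))); last first.
  by rewrite ler_wpM2l ?subr_ge0// trace_exp_drift// (le_trans x0).
rewrite -bmeas_RintegralZ//; apply: bmeas_le_Rintegral.
- exact: bmeasB.
- exact: (bmeasM (bmeas_cst _) bXm).
- by move=> w; exact: rtr_mxexp_convex.
Qed.

End bounded_summands.

(** * Largest eigenvalue *)

Section lambda_max_bounded.
Context {R : realType} {d0 : measure_display} {T : measurableType d0} {d : nat}.
Variable P : probability T R.
Variable X : T -> 'M[R[i]]_d.
Hypotheses (d_gt0 : (0 < d)%N) (bX : bmx X) (hX : forall w, X w \is hermsymmx).

Let d_gt0R : 0 < d%:R :> R. Proof. by rewrite ltr0n. Qed.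

Let rtr_gt0 th w : 0 < rtr (mxexp th (X w)).
Proof. exact: lt_le_trans (expR_gt0 _) (expR_le_rtr_mxexp th d_gt0 (hX w)). Qed.

Let bE th : bmeas (fun w => rtr (mxexp th (X w))).
Proof. exact: bmeas_rtr (bmx_mxexp th hX bX). Qed.

Lemma lambda_max_bmeas : bmeas (fun w => lambda_max (X w)).
Proof.
split; last first.
  have [C C0 XC] := bmx_entries_le bX.
  exists (1 + \sum_(i < d) \sum_(j < d) (C ^+ 2 + C ^+ 2)) => w.
  by have [i ->] := lambda_max_attained d_gt0 (hX w); exact: eigs_bounded.
pose h (N : nat) w := ln (rtr (mxexp N.+1%:R (X w))) / N.+1%:R.
apply: (measurable_fun_cvg (h := h)) => [N|w _].
  apply: measurable_funM => //; apply: measurableT_comp; first exact: measurable_ln.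
  exact: (bE _).1.
apply: (@squeeze_cvgr _ _ _ _ (fun=> lambda_max (X w))
    (fun N => lambda_max (X w) + ln d%:R * harmonic N)).
- apply: nearW => N; rewrite /h /harmonic /=.
  have N0 : 0 < N.+1%:R :> R by rewrite ltr0n.
  rewrite ler_pdivlMr//.
  apply/andP; split.
    rewrite mulrC -[leLHS]expRK ler_ln ?posrE ?expR_gt0//.
    exact: expR_le_rtr_mxexp.
  rewrite ler_pdivrMr// mulrDl mulfVK ?gt_eqF// addrC mulrC.
  rewrite -[X in _ <= _ + X]expRK -lnM ?posrE ?expR_gt0// ler_ln ?posrE ?mulr_gt0 ?expR_gt0//.
  exact: rtr_mxexp_le.
- exact: cvg_cst.
- rewrite -[X in _ --> X]addr0 -[X in _ + X](mulr0 (ln d%:R)).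
  apply: cvgD; first exact: cvg_cst.
  by apply: cvgMr; exact: cvg_harmonic.
Qed.

Lemma lambda_max_tail th t : 0 <= th ->
  (P [set w | (t <= lambda_max (X w))%R] <=
   (expR (- (th * t)) * \int[P]_w rtr (mxexp th (X w)))%:E)%E.
Proof.
move=> th0; set A := [set w | _].
have mA : measurable A.
  have := lambda_max_bmeas.1 measurableT _ (measurable_itv `[t, +oo[).
  rewrite setTI; congr measurable; apply/funext => w /=.
  by rewrite in_itv/= andbT.
have b1 : bmeas (\1_A : T -> R).
  split; first exact: measurable_indic.
  by exists 1 => w; rewrite ger0_norm// indicE; case: (_ \in _).
have -> : P A = (\int[P]_w (\1_A w : R))%:E.
  by rewrite -bmeas_RintegralE// integral_indic// setIT.
rewrite lee_fin -bmeas_RintegralZ//; apply: bmeas_le_Rintegral => //.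
  exact: (bmeasM (bmeas_cst _) (bE th)).
move=> w; rewrite indicE; case: (boolP (w \in A)) => [|_]; last first.
  by rewrite mulr_ge0 ?expR_ge0// ltW.
rewrite inE => tw.
apply: (@le_trans _ _ (expR (- (th * t)) * expR (th * lambda_max (X w)))).
  rewrite -expRD -[leLHS]expR0 ler_expR addrC subr_ge0.
  by rewrite ler_wpM2l.
by rewrite ler_wpM2l ?expR_ge0// expR_le_rtr_mxexp.
Qed.

Lemma lambda_max_expectation th v :
  \int[P]_w rtr (mxexp th (X w)) <= d%:R * expR v ->
  th * \int[P]_w lambda_max (X w) <= ln d%:R + v.
Proof.
set c := d%:R * expR v => mc; have c0 : 0 < c by rewrite mulr_gt0 ?expR_gt0.
have lnc : ln c = ln d%:R + v by rewrite lnM ?posrE ?expR_gt0// expRK.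
have bl := lambda_max_bmeas.
pose g w := (ln c - 1) + c^-1 * rtr (mxexp th (X w)).
have bg1 : bmeas (fun w => c^-1 * rtr (mxexp th (X w))).
  exact: (bmeasM (bmeas_cst _) (bE th)).
have bk : bmeas (fun _ : T => ln c - 1) := bmeas_cst _.
have bg : bmeas g by exact: bmeasD.
rewrite -lnc -bmeas_RintegralZ//.
apply: (@le_trans _ _ (\int[P]_w g w)).
  apply: bmeas_le_Rintegral => //; first exact: (bmeasM (bmeas_cst th) bl).
  move=> w; rewrite /g.
  have := expR_ge1Dx (th * lambda_max (X w) - ln c).
  rewrite expRB (lnK _) ?posrE// => h1.
  have := expR_le_rtr_mxexp th d_gt0 (hX w).
  rewrite -(ler_pM2l (_ : 0 < c^-1)) ?invr_gt0// => h2.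
  rewrite [_ / c]mulrC in h1; have := le_trans h1 h2; lra.
rewrite bmeas_RintegralD// bmeas_RintegralZ// bmeas_Rintegral_cst.
rewrite -[leRHS]addr0 -addrA lerD2l addrC subr_le0.
by rewrite mulrC ler_pdivrMr// mul1r.
Qed.

End lambda_max_bounded.

Section optimisation.
Context {R : realType}.

Lemma subgaussian_expectation (mu L sigma : R) : 0 <= L -> 0 <= sigma ->
  (forall th, 0 <= th -> th * mu <= L + sigma ^+ 2 * th ^+ 2 / 2) ->
  mu <= sigma * Num.sqrt (2 * L).
Proof.
move=> L0 s0 h; set q := Num.sqrt (2 * L).
have q0 : 0 <= q by exact: sqrtr_ge0.
have qE : q ^+ 2 = 2 * L by rewrite sqr_sqrtr// mulr_ge0.
have [sE|s_neq0] := eqVneq sigma 0.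
  rewrite sE mul0r leNgt; apply/negP => mu0.
  have := h ((L + 1) / mu); rewrite divr_ge0 ?addr_ge0 ?(ltW mu0)// => /(_ isT).
  rewrite divfK ?gt_eqF// sE expr0n/= !mul0r; lra.
have {s_neq0} sp : 0 < sigma by rewrite lt_neqAle eq_sym s_neq0.
have [qq|q_neq0] := eqVneq q 0.
  have L_eq0 : L = 0 by move: qE; rewrite qq expr0n/=; lra.
  rewrite qq mulr0 leNgt; apply/negP => mu0.
  have s2 : 0 < sigma ^+ 2 by rewrite exprn_gt0.
  have := h (mu / sigma ^+ 2); rewrite divr_ge0 ?(ltW mu0) ?(ltW s2)// => /(_ isT).
  have -> : sigma ^+ 2 * (mu / sigma ^+ 2) ^+ 2 / 2 = mu / sigma ^+ 2 * mu / 2.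
    by field; rewrite gt_eqF.
  have : 0 < mu / sigma ^+ 2 * mu by rewrite !mulr_gt0// invr_gt0.
  lra.
have {q_neq0} qp : 0 < q by rewrite lt_neqAle eq_sym q_neq0.
have := h (q / sigma); rewrite divr_ge0// => /(_ isT).
have -> : L + sigma ^+ 2 * (q / sigma) ^+ 2 / 2 = q / sigma * (sigma * q).
  by rewrite (_ : L = q ^+ 2 / 2); [field; rewrite gt_eqF|rewrite qE; field].
by rewrite ler_pM2l// divr_gt0.
Qed.

Lemma subgaussian_tail (p c t sigma : R) : 0 < c -> 0 <= sigma -> 0 <= t ->
  (forall th, 0 <= th -> p <= expR (- (th * t)) * (c * expR (sigma ^+ 2 * th ^+ 2 / 2))) ->
  (p%:E <= c%:E * expeR (- ((t ^+ 2)%:E / (2 * sigma ^+ 2)%:E)))%E.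
Proof.
move=> c0 s0 t0 h.
have [sE|s_neq0] := eqVneq sigma 0.
  rewrite sE expr0n/= mulr0.
  have h0 th : 0 <= th -> p <= expR (- (th * t)) * c.
    by move=> /h; rewrite sE expr0n/= !mul0r expR0 mulr1.
  have [tE|t_neq0] := eqVneq t 0.
    rewrite tE expr0n/= mul0e oppe0 expeR0 mule1 lee_fin.
    by have := h0 0; rewrite !mul0r oppr0 expR0 mul1r; apply.
  have {t_neq0} tp : 0 < t by rewrite lt_neqAle eq_sym t_neq0.
  have -> : ((t ^+ 2)%:E / 0%:E = +oo :> \bar R)%E.
    by rewrite inve0 gt0_muley// lte_fin exprn_gt0.
  rewrite /= mule0 lee_fin leNgt; apply/negP => p0.
  have := h0 (c / p / t); rewrite !divr_ge0 ?(ltW p0) ?(ltW c0)// => /(_ isT).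
  rewrite divfK ?gt_eqF// expRN mulrC ler_pdivlMr ?expR_gt0//.
  have := ler_wpM2l (ltW p0) (expR_ge1Dx (c / p)).
  rewrite mulrDr mulr1 mulrCA mulfV ?gt_eqF// mulr1; lra.
have {s_neq0} sp : 0 < sigma by rewrite lt_neqAle eq_sym s_neq0.
have s2 : 0 < sigma ^+ 2 by rewrite exprn_gt0.
rewrite inver mulf_eq0 gt_eqF//= (gt_eqF s2)/=.
rewrite -EFinM lee_fin.
have := h (t / sigma ^+ 2); rewrite divr_ge0 ?(ltW s2)// => /(_ isT).
rewrite mulrCA -expRD => /le_trans; apply.
rewrite ler_pM2l// ler_expR le_eqVlt; apply/orP; left; apply/eqP.
by field; rewrite gt_eqF.
Qed.

End optimisation.

(** * Truncation *)

Section clamp.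
Context {R : realType} {d : nat}.
Implicit Types (C x : R) (M : 'M[R[i]]_d).

Definition clamp C x := Num.max (- C) (Num.min x C).

Lemma clamp_le C x : 0 <= C -> `|clamp C x| <= C.
Proof.
move=> C0; rewrite ler_norml /clamp le_max lexx /= ge_max ge_min lexx orbT andbT.
by rewrite (le_trans _ C0)// oppr_le0.
Qed.

Lemma clamp_id C x : `|x| <= C -> clamp C x = x.
Proof.
by rewrite ler_norml /clamp => /andP[h1 h2]; rewrite (min_idPl h2); apply/max_idPr.
Qed.

Lemma clampN C x : 0 <= C -> clamp C (- x) = - clamp C x.
Proof.
move=> C0; have hi y : C <= y -> clamp C y = C.
  by move=> Cy; rewrite /clamp (min_idPr Cy); apply/max_idPr; lra.
have lo y : y <= - C -> clamp C y = - C.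
  move=> yC; rewrite /clamp (min_idPl _); first exact/max_idPl.
  by rewrite (le_trans yC)//; lra.
have [xC|Cx] := leP x C; last by rewrite (hi x (ltW Cx)) lo// lerN2 ltW.
have [Cx|xC'] := leP (- C) x; last first.
  by rewrite (lo x (ltW xC')) opprK hi// lerNr ltW.
by rewrite !clamp_id ?normrN// ler_norml Cx.
Qed.

Definition mxclamp C M : 'M[R[i]]_d :=
  \matrix_(i, j) (clamp C (complex.Re (M i j)) +i* clamp C (complex.Im (M i j))).

Lemma mxclamp_entries_le C M : 0 <= C -> entries_le C (mxclamp C M).
Proof. by move=> C0 i j; rewrite mxE; split; exact: clamp_le. Qed.

Lemma mxclamp_id C M : entries_le C M -> mxclamp C M = M.
Proof.
move=> MC; apply/matrixP => i j; rewrite mxE; have [h1 h2] := MC i j.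
by rewrite !clamp_id//; case: (M i j).
Qed.

Lemma mxclamp_herm C M : 0 <= C -> M \is hermsymmx -> mxclamp C M \is hermsymmx.
Proof.
move=> C0 /hermsymmxP hM; apply/hermsymmxP/matrixP => i j.
have ME : M i j = (M j i)^* by rewrite -{1}hM !mxE.
rewrite !mxE ME; case: (M j i) => a b /=.
by rewrite clampN.
Qed.

Lemma random_mx_mxclamp {d0 : measure_display} {T : measurableType d0} C
  (X : T -> 'M[R[i]]_d) : random_mx X -> random_mx (fun w => mxclamp C (X w)).
Proof.
have mclamp (f : T -> R) : measurable_fun setT f -> measurable_fun setT (fun w => clamp C (f w)).
  move=> mf; apply: measurable_maxr => //; exact: measurable_minr.
move=> /random_mxP mX; apply/random_mxP => i j; have [m1 m2] := mX i j.
by split; under eq_fun do rewrite mxE /=; exact: mclamp.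
Qed.

Lemma mx_borel_mxclamp C (B : set 'M[R[i]]_d) : mx_borel B -> mx_borel (mxclamp C @^-1` B).
Proof.
have mid : random_mx (id : g_sigma_algebraType (@mx_entry_events R d) -> 'M[R[i]]_d).
  by move=> D.
exact: (random_mx_mxclamp C mid).
Qed.

Lemma entries_le_ub M : exists C, entries_le C M.
Proof.
exists (\sum_i \sum_j (`|complex.Re (M i j)| + `|complex.Im (M i j)|)) => i j.
have h : `|complex.Re (M i j)| + `|complex.Im (M i j)| <=
    \sum_i \sum_j (`|complex.Re (M i j)| + `|complex.Im (M i j)|).
  rewrite [leRHS](bigD1 i)//= [X in _ <= X + _](bigD1 j)//= -addrA lerDl.
  by rewrite addr_ge0//; do ?[apply: sumr_ge0 => ? _]; rewrite addr_ge0.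
by split; apply: le_trans h; rewrite ?lerDl ?lerDr.
Qed.

Lemma entries_leW C D M : C <= D -> entries_le C M -> entries_le D M.
Proof. by move=> CD MC i j; have [h1 h2] := MC i j; split; exact: le_trans CD. Qed.

Lemma psdmx_diag_ge0 M i : psdmx M -> 0 <= M i i.
Proof.
move=> [_ /(_ (delta_mx i 0))].
have -> : (delta_mx i 0 : 'cV[R[i]]_d)^t* = delta_mx 0 i.
  by apply/matrixP => a b; rewrite !mxE conjC_nat andbC.
by rewrite -rowE -colE !mxE.
Qed.

Lemma loewner_sqr_entries_le (A M : 'M[R[i]]_d) : M \is hermsymmx ->
  loewner_le (M ^+ 2) (A ^+ 2) ->
  entries_le (1 + \sum_i `|complex.Re ((A ^+ 2) i i)|) M.
Proof.
move=> /hermsymmxP hM MA i j.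
have Mii : complex.Re ((M ^+ 2) i i) =
    \sum_j (complex.Re (M i j) ^+ 2 + complex.Im (M i j) ^+ 2).
  rewrite expr2 mxE Re_sum; apply: eq_bigr => l _.
  suff -> : M l i = (M i l)^* by rewrite Re_conjM.
  by rewrite -[in LHS]hM !mxE.
have le_ii : complex.Re ((M ^+ 2) i i) <= complex.Re ((A ^+ 2) i i).
  have := psdmx_diag_ge0 i MA; move: (A ^+ 2) (M ^+ 2) => B D.
  by rewrite mxE [X in _ + X]mxE lecE => /andP[_]; rewrite cReB subr_ge0.
have A_le : complex.Re ((A ^+ 2) i i) <= \sum_i `|complex.Re ((A ^+ 2) i i)|.
  by rewrite (bigD1 i)//= (le_trans (ler_norm _))// lerDl sumr_ge0.
have M_ge : complex.Re (M i j) ^+ 2 + complex.Im (M i j) ^+ 2 <=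
    complex.Re ((M ^+ 2) i i).
  rewrite Mii (bigD1 j)//= lerDl; apply: sumr_ge0 => ? _.
  by rewrite addr_ge0 ?sqr_ge0.
have := le_trans M_ge (le_trans le_ii A_le).
move: (complex.Re (M i j)) (complex.Im (M i j)) (\sum_i _) => x y S xyS.
have le_norm z : z ^+ 2 <= S -> `|z| <= 1 + S.
  move=> zS; rewrite (@le_trans _ _ (1 + z ^+ 2)) ?lerD2l//.
  rewrite -(real_normK (num_real z)).
  by have := sqr_ge0 (`|z| - 1); have := normr_ge0 z; nra.
by split; apply: le_norm; have := sqr_ge0 x; have := sqr_ge0 y; lra.
Qed.

End clamp.

Section transfer.
Context {R : realType} {d0 : measure_display} {T : measurableType d0} {d : nat}.
Variable P : probability T R.
Implicit Types X Y : T -> 'M[R[i]]_d.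

Lemma random_mx_sum (I : Type) (r : seq I) (F : I -> T -> 'M[R[i]]_d) :
  (forall i, random_mx (F i)) -> random_mx (fun w => \sum_(i <- r) F i w).
Proof.
move=> mF; apply/random_mxP => a b; split.
  under eq_fun do rewrite summxE Re_sum.
  by apply: measurable_sum => i; have [] := (random_mxP (F i)).1 (mF i) a b.
under eq_fun do rewrite summxE Im_sum.
by apply: measurable_sum => i; have [] := (random_mxP (F i)).1 (mF i) a b.
Qed.

Lemma random_mx_sqr X : random_mx X -> random_mx (fun w => X w ^+ 2).
Proof.
move=> /random_mxP mX; apply/random_mxP => a b; split.
  under eq_fun do rewrite expr2 mxE Re_sum.
  apply: measurable_sum => c; under eq_fun do rewrite cReM.
  exact: (measurable_funB (measurable_funM (mX a c).1 (mX c b).1)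
    (measurable_funM (mX a c).2 (mX c b).2)).
under eq_fun do rewrite expr2 mxE Im_sum.
apply: measurable_sum => c; under eq_fun do rewrite cImM.
exact: (measurable_funD (measurable_funM (mX a c).1 (mX c b).2)
  (measurable_funM (mX a c).2 (mX c b).1)).
Qed.

Lemma ae_eq_mx_expectation X Y : random_mx X -> random_mx Y ->
  {ae P, forall w, X w = Y w} -> mx_expectation P X = mx_expectation P Y.
Proof.
move=> /random_mxP mX /random_mxP mY XY; apply/matrixP => i j.
rewrite !mxE !unlock; have [mX1 mX2] := mX i j; have [mY1 mY2] := mY i j.
congr (fine _ +i* fine _); apply: ae_eq_integral => //; try exact/measurable_EFinP.
  by apply: filterS XY => w XYw _ /=; rewrite XYw.
by apply: filterS XY => w XYw _ /=; rewrite XYw.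
Qed.

Lemma measurable_lambda_max X : (0 < d)%N -> random_mx X ->
  (forall w, X w \is hermsymmx) -> measurable_fun setT (fun w => lambda_max (X w)).
Proof.
move=> d_gt0 mX hX.
apply: (measurable_fun_cvg (h := fun N w => lambda_max (mxclamp N%:R (X w)))) => [N|w _].
  have b : bmx (fun w => mxclamp N%:R (X w)).
    apply: (random_mx_bmx (random_mx_mxclamp _ mX)) => w.
    exact: mxclamp_entries_le.
  have h w : mxclamp N%:R (X w) \is hermsymmx by exact: mxclamp_herm.
  exact: (lambda_max_bmeas d_gt0 b h).1.
have [C XC] := entries_le_ub (X w).
apply: cvg_near_cst; near=> N; rewrite mxclamp_id//; apply: entries_leW XC.
near: N; exact: nbhs_infty_ger.
Unshelve. all: by end_near. Qed.

Lemma ae_le_measure (A B : set T) : measurable A -> measurable B ->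
  {ae P, forall w, A w -> B w} -> (P A <= P B)%E.
Proof.
move=> mA mB [N [mN N0 AB]].
have AU : A `<=` B `|` N.
  move=> w Aw; have [Bw|nBw] := pselect (B w); first by left.
  by right; apply: AB => /(_ Aw).
apply: (@le_trans _ _ (P (B `|` N))).
  by apply: le_measure => //; rewrite inE//; exact: measurableU.
apply: le_trans (measureU2 _ _ _) _ => //.
by move: N0 => /= ->; rewrite adde0.
Qed.

End transfer.

Theorem corollary4p2 (R : realType) (disp : measure_display)
  (T : measurableType disp) (P : probability T R) (d n : nat)
  (Y : 'I_n -> T -> 'M[R[i]]_d) (A : 'I_n -> 'M[R[i]]_d) (sigma : R)
  (hd : (0 < d)%N)
  (hYmeas : forall k, random_mx (Y k))
  (hYherm : forall k w, Y k w \is hermsymmx)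
  (hYindep : mutually_independent P Y)
  (hAherm : forall k, A k \is hermsymmx)
  (hYmean : forall k, mx_expectation P (Y k) = 0)
  (hYA : forall k, {ae P, forall w, loewner_le (Y k w ^+ 2) (A k ^+ 2)})
  (hsigma0 : 0 <= sigma)
  (hsigma : sigma ^+ 2 = 2^-1 *
     spectral_norm
       (\sum_(k < n) (A k ^+ 2 + mx_expectation P (fun w => Y k w ^+ 2)))) :
  (* The exponent is computed in the extended reals, where 1 / 0 = +oo and
     0 * +oo = 0: if sigma = 0 and t > 0 the right-hand side is 0. *)
  (forall t : R, 0 <= t ->
     (P [set w | (t <= lambda_max (\sum_(k < n) Y k w))%R] <=
      d%:R%:E * expeR (- ((t ^+ 2)%:E / (2 * sigma ^+ 2)%:E)))%E) /\
  ('E_P[fun w => lambda_max (\sum_(k < n) Y k w)%R] <=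
   (sigma * Num.sqrt (2 * ln d%:R))%:E)%E.
Proof.
pose C : R := \sum_k (1 + \sum_i `|complex.Re ((A k ^+ 2) i i)|).
have Ck_ge0 k : 0 <= 1 + \sum_i `|complex.Re ((A k ^+ 2) i i)|.
  by rewrite addr_ge0// sumr_ge0.
have C_ge0 : 0 <= C by exact: sumr_ge0.
have C_ge k : 1 + \sum_i `|complex.Re ((A k ^+ 2) i i)| <= C.
  by rewrite /C [leRHS](bigD1 k)//= lerDl sumr_ge0.
(* Clamping the entries at the a.s. bound C makes the summands bounded everywhere. *)
pose Z k w := mxclamp C (Y k w).
have ZY : {ae P, forall w, forall k, Z k w = Y k w}.
  have : {ae P, forall w, forall k, loewner_le (Y k w ^+ 2) (A k ^+ 2)}.
    exact: (@filter_forall _ _ (fun k => [set w | loewner_le (Y k w ^+ 2) (A k ^+ 2)])).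
  apply: filterS => w YA k; apply: mxclamp_id.
  exact: entries_leW (C_ge k) (loewner_sqr_entries_le (hYherm k w) (YA k)).
have ZYk k : {ae P, forall w, Z k w = Y k w} by apply: filterS ZY => w.
have mZ k : random_mx (Z k) by exact: random_mx_mxclamp.
have hZ k w : Z k w \is hermsymmx by exact: mxclamp_herm.
have bZ k w : entries_le C (Z k w) by exact: mxclamp_entries_le.
have iZ : mutually_independent P Z.
  move=> J B mB; exact: (hYindep J (fun k => mxclamp C @^-1` B k)
    (fun k => mx_borel_mxclamp C (mB k))).
have EZ k : mx_expectation P (Z k) = 0.
  by rewrite (ae_eq_mx_expectation (mZ k) (hYmeas k) (ZYk k)).
have EZ2 k : mx_expectation P (fun w => Z k w ^+ 2) = mx_expectation P (fun w => Y k w ^+ 2).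
  apply: ae_eq_mx_expectation; try exact: random_mx_sqr.
  by apply: filterS (ZYk k) => w ->.
have ZA k : {ae P, forall w, loewner_le (Z k w ^+ 2) (A k ^+ 2)}.
  by apply: filterS2 (ZYk k) (hYA k) => w ->.
have sigmaE : sigma ^+ 2 = 2^-1 * spectral_norm
    (\sum_(k < n) (A k ^+ 2 + mx_expectation P (fun w => Z k w ^+ 2))).
  by rewrite hsigma; congr (_ * spectral_norm _); apply: eq_bigr => k _; rewrite EZ2.
have mgf := trace_mgf_bound mZ hZ iZ bZ hAherm EZ ZA sigmaE.
pose X w := \sum_k Z k w.
have bX : bmx X := bmx_sum (index_enum 'I_n) xpredT (fun k => random_mx_bmx (mZ k) (bZ k)).
have hX w : X w \is hermsymmx by exact: hermsymmx_sum.
have XY : {ae P, forall w, X w = \sum_k Y k w}.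
  by apply: filterS ZY => w ZYw; apply: eq_bigr => k _.
have mXmax := (lambda_max_bmeas hd bX hX).1.
have mYmax : measurable_fun setT (fun w => lambda_max (\sum_(k < n) Y k w)).
  apply: measurable_lambda_max => //; first exact: random_mx_sum.
  by move=> w; exact: hermsymmx_sum.
split => [t t0|].
  have mtail f : measurable_fun setT f -> measurable [set w : T | t <= f w].
    move=> mf; have := mf measurableT _ (measurable_itv `[t, +oo[).
    rewrite setTI; congr measurable; apply/funext => w /=.
    by rewrite in_itv/= andbT.
  apply: (@le_trans _ _ (P [set w | t <= lambda_max (X w)])).
    apply: ae_le_measure; try exact: mtail.
    by apply: filterS XY => w /= ->.
  rewrite -[leLHS]fineK ?fin_num_measure//; last exact: mtail.
  apply: subgaussian_tail => //; first by rewrite ltr0n.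
  move=> th th0; rewrite -lee_fin fineK ?fin_num_measure//; last exact: mtail.
  apply: le_trans (lambda_max_tail P hd bX hX t th0) _.
  by rewrite lee_fin ler_wpM2l ?expR_ge0// mgf.
have -> : ('E_P[fun w => lambda_max (\sum_(k < n) Y k w)%R] =
    (\int[P]_w lambda_max (X w))%:E)%E.
  rewrite unlock -(bmeas_RintegralE P (lambda_max_bmeas hd bX hX)).
  apply: ae_eq_integral; [exact: measurableT|exact/measurable_EFinP/mYmax
    |exact/measurable_EFinP/mXmax|].
  by apply: filterS XY => w XYw _ /=; rewrite XYw.
rewrite lee_fin; apply: subgaussian_expectation => //.
  by rewrite ln_ge0// ler1n.
move=> th th0; apply: lambda_max_expectation => //.
exact: mgf.
Qed.
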